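(* Let $k$ be a perfect field of characteristic $p>0$, $M=\mathbb Z^n$, and $H=\operatorname{Spec}kM$. Let $Y$ be the toric variety over $k$ defined by a fan $\Delta$ in $M^*=\operatorname{Hom}_{\mathbb Z}(M,\mathbb Z)$. Then $Y$ is of graded finite $F$-representation type by some rank-one reflexive sheaves $\mathcal M_1,\dots,\mathcal M_u$ on $Y$, with respect to the action of $H$.
   Context: $kM$ is the group algebra of $M$, with each element of $M$ group-like, so that $H$ is a split torus acting on $Y$. For $e\ge0$, ${}^eH$ and ${}^eY$ denote $H$ and $Y$ regarded as the sources of the $e$-th iterated absolute Frobenius morphisms $F^e:{}^eH\to H$ and $F^e:{}^eY\to Y$ (with base $\operatorname{Spec}k$ twisted accordingly along $F^e$; $k$ is perfect). ${}^eH$ acts on ${}^eY$ in the obvious way and on $Y$ through $F^e:{}^eH\to H$, so $F^e_*\mathcal O_{{}^eY}$ is an ${}^eH$-equivariant coherent $\mathcal O_Y$-module (in terms of gradings on affine $H$-stable pieces, ${}^eH$-equivariant modules are $p^{-e}M$-graded modules). $\operatorname{Coh}({}^eH,Y)$ is the category of ${}^eH$-equivariant coherent $\mathcal O_Y$-modules. $Y$ is of graded finite $F$-representation type (with respect to $H$) by $\mathcal M_1,\dots,\mathcal M_u\in\operatorname{Coh}({}^{e_0}H,Y)$ (for some $e_0\ge0$) if for every $e\ge1$ one can write $F^e_*\mathcal O_{{}^eY}\cong\mathcal N_1\oplus\cdots\oplus\mathcal N_m$ with $\mathcal N_1,\dots,\mathcal N_m\in\operatorname{Coh}({}^eH,Y)$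 (an isomorphism of ${}^eH$-equivariant modules) such that for each $j$ there is some $l(j)$ with $\mathcal N_j\cong\mathcal M_{l(j)}$ as $\mathcal O_Y$-modules. *)

(* Defs.v *)
From HB Require Import structures.
From mathcomp Require Import all_boot all_algebra finmap.
From mathcomp Require Import boolp classical_sets cardinality reals.
From mathcomp Require Import monalg.

Set Implicit Arguments.
Unset Strict Implicit.
Unset Printing Implicit Defensive.

Import GRing.Theory Num.Theory.
Local Open Scope classical_set_scope.
Local Open Scope ring_scope.

(** [{malg k[M]}] is the library's type of finitely supported functions
    [M -> k]; its convolution product is only provided for monoids without
    nontrivial units, so the product is redone here for an abelian group. *)

Section GroupAlgebra.
Variables (k : comNzRingType) (M : zmodType).

Definition group_algebra : Type := {malg k[M]}.
HB.instance Definition _ := GRing.Zmodule.on group_algebra.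

Implicit Types f g h : group_algebra.

Definition ga_monom (c : k) (m : M) : group_algebra := << c *g m >>.

Definition ga_one : group_algebra := ga_monom 1 0.

Definition ga_mul f g : group_algebra :=
  \sum_(m1 <- msupp f) \sum_(m2 <- msupp g) << f@_m1 * g@_m2 *g (m1 + m2) >>.

Fact ga_mulw (d1 d2 : {fset M}) f g :
  (msupp f `<=` d1)%fset -> (msupp g `<=` d2)%fset ->
  ga_mul f g = \sum_(m1 <- d1) \sum_(m2 <- d2) << f@_m1 * g@_m2 *g (m1 + m2) >>.
Proof.
move=> le1 le2; rewrite /ga_mul (big_fset_incl _ le1) /=.
  apply/eq_bigr => m1 _; apply/big_fset_incl => // m _ /mcoeff_outdom ->.
  by rewrite mulr0 monalgU0.
move=> m _ /mcoeff_outdom fm.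
by rewrite big1 // => m' _; rewrite fm mul0r monalgU0.
Qed.

Fact ga_mulC : commutative ga_mul.
Proof.
move=> f g; rewrite /ga_mul exchange_big; apply/eq_bigr => m _.
by apply/eq_bigr => m' _; rewrite mulrC addrC.
Qed.

Fact ga_mulDl : left_distributive ga_mul +%R.
Proof.
move=> f1 f2 g.
rewrite (ga_mulw (msuppD_le f1 f2) (fsubset_refl _)).
rewrite (ga_mulw (fsubsetUl (msupp f1) (msupp f2)) (fsubset_refl _)).
rewrite (ga_mulw (fsubsetUr (msupp f1) (msupp f2)) (fsubset_refl _)).
rewrite -big_split /=; apply/eq_bigr => m1 _.
rewrite -big_split /=; apply/eq_bigr => m2 _.
by rewrite mcoeffD mulrDl monalgUD.
Qed.

Fact ga_mulDr : right_distributive ga_mul +%R.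
Proof. by move=> f g1 g2; rewrite ga_mulC ga_mulDl !(ga_mulC f). Qed.

Fact ga_mul0l : left_zero 0 ga_mul.
Proof. by move=> g; rewrite /ga_mul msupp0 big_seq_fset0. Qed.

Fact ga_mul0r : right_zero 0 ga_mul.
Proof. by move=> g; rewrite ga_mulC ga_mul0l. Qed.

Fact ga_mulUU c1 c2 m1 m2 :
  ga_mul << c1 *g m1 >> << c2 *g m2 >> = << c1 * c2 *g (m1 + m2) >>.
Proof. by rewrite (ga_mulw msuppU_le msuppU_le) !big_seq_fset1 !mcoeffUU. Qed.

Fact ga_mul1l : left_id ga_one ga_mul.
Proof.
move=> g; rewrite (ga_mulw msuppU_le (fsubset_refl _)) big_seq_fset1.
rewrite [RHS]monalgE; apply/eq_bigr => m _.
by rewrite mcoeffUU mul1r add0r.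
Qed.

Fact ga_mulA : associative ga_mul.
Proof.
have suml I (r : seq I) F g :
    ga_mul (\sum_(i <- r) F i) g = \sum_(i <- r) ga_mul (F i) g.
  exact: (big_morph (ga_mul^~ g) (fun x y => ga_mulDl x y g) (ga_mul0l g)).
have sumr I (r : seq I) F g :
    ga_mul g (\sum_(i <- r) F i) = \sum_(i <- r) ga_mul g (F i).
  exact: (big_morph (ga_mul g) (ga_mulDr g) (ga_mul0r g)).
have El f g : ga_mul f g = \sum_(m <- msupp f) ga_mul << f@_m *g m >> g.
  by rewrite {1}(monalgE f) (suml _ (msupp f)).
have Er f g : ga_mul f g = \sum_(m <- msupp g) ga_mul f << g@_m *g m >>.
  by rewrite {1}(monalgE g) (sumr _ (msupp g)).
move=> f g h.
rewrite (El f (ga_mul g h)) (El f g) (suml _ (msupp f)); apply/eq_bigr => m1 _.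
rewrite (El g h) (sumr _ (msupp g)) (Er _ g) (suml _ (msupp g)).
apply/eq_bigr => m2 _.
rewrite (Er _ h) (sumr _ (msupp h)) [RHS]Er; apply/eq_bigr => m3 _.
by rewrite !ga_mulUU mulrA addrA.
Qed.

Fact ga_one_neq0 : ga_one != 0.
Proof. by rewrite monalgU_eq0 oner_eq0. Qed.

HB.instance Definition _ := GRing.Zmodule_isComNzRing.Build group_algebra
  ga_mulA ga_mulC ga_mul1l ga_mulDl ga_one_neq0.

End GroupAlgebra.

(** For [M = Z^n = 'rV[int]_n], [M^*] is identified with [Z^n], and [M^* (x) R] with
    [R^n], through the standard pairing. *)

Section Fans.
Variables (R : realType) (n : nat).
Implicit Types (s t : set 'rV[R]_n) (u v : 'rV[R]_n).

Definition pairing u v : R := (u *m v^T) 0 0.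

Definition lattice_vec (m : 'rV[int]_n) : 'rV[R]_n := map_mx intr m.

Definition cone_span (g : seq 'rV[int]_n) : set 'rV[R]_n :=
  [set v | exists2 c : 'I_(size g) -> R, (forall i, 0 <= c i)
    & v = \sum_i c i *: lattice_vec (tnth (in_tuple g) i)].

Definition is_cone s : Prop :=
  (exists g, s = cone_span g) /\ (forall v, s v -> s (- v) -> v = 0).

Definition face t s : Prop :=
  exists2 u, (forall v, s v -> 0 <= pairing u v)
    & t = [set v | s v /\ pairing u v = 0].

Definition is_fan (D : set (set 'rV[R]_n)) : Prop :=
  [/\ finite_set D /\ D !=set0,
      forall s, D s -> is_cone s,
      forall s t, D s -> face t s -> D t
    & forall s t, D s -> D t -> face (s `&` t) s /\ face (s `&` t) t].

Definition dual_cone s : set 'rV[int]_n :=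
  [set m | forall v, s v -> 0 <= pairing (lattice_vec m) v].

Fact dual_cone0 s : dual_cone s 0.
Proof.
by move=> v _; rewrite /pairing mxE big1 // => i _; rewrite !mxE mul0r.
Qed.

Fact dual_coneD s m m' : dual_cone s m -> dual_cone s m' -> dual_cone s (m + m').
Proof.
move=> sm sm' v sv; rewrite /pairing /lattice_vec map_mxD mulmxDl mxE.
by rewrite addr_ge0 //; [exact: sm | exact: sm'].
Qed.

End Fans.

Section CoordRing.
Variables (R : realType) (n : nat) (k : comNzRingType) (s : set 'rV[R]_n).
Local Notation kM := (group_algebra k 'rV[int]_n).

Definition semigroup_alg : {pred kM} :=
  [pred f : kM | `[< forall m, m \in msupp f -> dual_cone s m >]].

Fact semigroup_algP (f : kM) :
  reflect (forall m, f@_m != 0 -> dual_cone s m) (f \in semigroup_alg).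
Proof.
apply: (iffP (asboolP _)) => h m.
  by rewrite mcoeff_neq0; apply: h.
by rewrite -mcoeff_neq0; apply: h.
Qed.

Fact semigroup_alg_subring : subring_closed semigroup_alg.
Proof.
split=> [|f g /semigroup_algP hf /semigroup_algP hg
         |f g /semigroup_algP hf /semigroup_algP hg]; apply/semigroup_algP => m.
- rewrite mcoeffU; have [<- _|_] := eqVneq 0 m; first exact: dual_cone0.
  by rewrite eqxx.
- rewrite mcoeffB => fg; have [fm|fm] := eqVneq (f@_m) 0; last exact: hf.
  by apply: hg; apply: contraNneq fg => ->; rewrite fm subr0.
- rewrite -[f * g]/(ga_mul f g) /ga_mul raddf_sum /= => fg.
  apply: contrapT => nm; case/eqP: fg; rewrite big_seq big1 // => m1 f1.
  rewrite raddf_sum /= big_seq big1 // => m2 g2; rewrite mcoeffU.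
  case: eqP => // e; case: nm; rewrite -e; apply: dual_coneD.
    by apply: hf; rewrite mcoeff_neq0.
  by apply: hg; rewrite mcoeff_neq0.
Qed.

HB.instance Definition _ :=
  GRing.isSubringClosed.Build kM semigroup_alg semigroup_alg_subring.

Definition coord_ring : Type := {f : kM | f \in semigroup_alg}.
HB.instance Definition _ := [isSub of coord_ring for @sval _ _].
HB.instance Definition _ := [Choice of coord_ring by <:].
HB.instance Definition _ := [SubChoice_isSubComNzRing of coord_ring by <:].

Definition homogeneous (m : 'rV[int]_n) : set coord_ring :=
  [set a | exists c : k, val a = ga_monom c m].

Fact homogeneous0 m : homogeneous m 0.
Proof. by exists 0; rewrite /ga_monom monalgU0. Qed.

Fact homogeneousD m (a b : coord_ring) :
  homogeneous m a -> homogeneous m b -> homogeneous m (a + b).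
Proof.
case=> c ac [d bd]; exists (c + d); rewrite rmorphD /=.
rewrite [\val a]ac [\val b]bd; apply/esym; exact: monalgUD.
Qed.

Fact homogeneousM m m' (a b : coord_ring) :
  homogeneous m a -> homogeneous m' b -> homogeneous (m + m') (a * b).
Proof.
case=> c ac [d bd]; exists (c * d); rewrite rmorphM /=.
rewrite [\val a]ac [\val b]bd; exact: ga_mulUU.
Qed.

Fact homogeneous_gen (a : coord_ring) :
  exists (l : seq 'rV[int]_n) (c : 'rV[int]_n -> coord_ring),
    [/\ uniq l, forall d, homogeneous d (c d) & a = \sum_(d <- l) c d].
Proof.
have cP d : ga_monom ((val a)@_d) d \in semigroup_alg.
  apply/semigroup_algP => m; rewrite mcoeffU.
  have [<-|_] := eqVneq d m; last by rewrite eqxx.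
  by move=> ad; move/semigroup_algP: (valP a); apply.
pose c d : coord_ring := exist _ (ga_monom ((val a)@_d) d) (cP d).
exists (msupp (val a)), c; split; first exact: fset_uniq.
  by move=> d; exists (val a)@_d.
by apply: val_inj; rewrite [LHS]monalgE raddf_sum.
Qed.

Fact homogeneous_free (l : seq 'rV[int]_n) (c : 'rV[int]_n -> coord_ring) :
  uniq l -> (forall d, homogeneous d (c d)) -> \sum_(d <- l) c d = 0 ->
  forall d, d \in l -> c d = 0.
Proof.
move=> ul /boolp.choice[b bE] c0 d dl; apply: val_inj.
have : mcoeff d (val (\sum_(d' <- l) c d')) = 0 by rewrite c0 mcoeff0.
have -> : val (\sum_(d' <- l) c d') = \sum_(d' <- l) ga_monom (b d') d'.
  by rewrite raddf_sum; apply/eq_bigr => d' _; exact: bE.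
rewrite raddf_sum (bigD1_seq d) //= big1 => [|d' dd']; last first.
  by rewrite mcoeffU (negPf dd').
by rewrite addr0 mcoeffUU [\val _]bE => ->; exact: monalgU0.
Qed.

Fact homogeneousX m (a : coord_ring) N :
  homogeneous m a -> homogeneous (m *+ N) (a ^+ N).
Proof.
move=> ma; elim: N => [|N IH]; first exact: (ex_intro _ 1 erefl).
by rewrite exprS mulrS; apply: homogeneousM.
Qed.

Fact coord_ring_pchar p : p \in [pchar k] -> p \in [pchar coord_ring].
Proof.
move=> hp; rewrite inE (pcharf_prime hp) /=; apply/eqP/val_inj.
rewrite rmorphMn rmorph1 rmorph0 /=.
have -> : 1 *+ p = ga_monom (1 *+ p : k) (0 : 'rV[int]_n) :> kM.
  by rewrite /ga_monom monalgUMn.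
by rewrite (pcharf0 hp); apply: monalgU0.
Qed.

End CoordRing.

Arguments semigroup_alg {R n} k s.

Section FrobeniusModule.
Variables (A : comNzRingType) (p : nat) (hp : p \in [pchar A]) (e : nat).

Definition frob_module of p \in [pchar A] & nat : Type := A.
Local Notation FA := (frob_module hp e).
HB.instance Definition _ := GRing.Zmodule.on FA.

Definition frob_scale (a : A) (x : FA) : FA := a ^+ (p ^ e) * (x : A).

Fact frob_scaleA a b x : frob_scale a (frob_scale b x) = frob_scale (a * b) x.
Proof. by rewrite /frob_scale exprMn mulrA. Qed.
Fact frob_scale1 : left_id 1 frob_scale.
Proof. by move=> x; rewrite /frob_scale expr1n mul1r. Qed.
Fact frob_scaleDr : right_distributive frob_scale +%R.
Proof. by move=> a x y; rewrite /frob_scale mulrDr. Qed.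
Fact frob_scaleDl x : {morph frob_scale^~ x : a b / a + b}.
Proof.
move=> a b; rewrite /frob_scale -mulrDl exprDn_pchar //.
by rewrite pnatX pnatE ?(pcharf_prime hp) ?hp.
Qed.

HB.instance Definition _ := GRing.Zmodule_isLmodule.Build A FA
  frob_scaleA frob_scale1 frob_scaleDr frob_scaleDl.

End FrobeniusModule.

Section Dual.
Variables (A : comNzRingType) (V : lmodType A).

Definition dual : Type := {linear V -> A^o}.
HB.instance Definition _ := gen_eqMixin dual.
HB.instance Definition _ := gen_choiceMixin dual.

Definition dual_eval (f : dual) (x : V) : A := (f : {linear V -> A^o}) x.

Fact dual_ext (f g : dual) : dual_eval f =1 dual_eval g -> f = g.
Proof.
case: f g => [f [[cf] [hf]]] [g [[cg] [hg]]] /= fg.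
have e : f = g by apply: funext => x; exact: fg.
subst g; congr (GRing.Linear.Pack (GRing.Linear.Class _ _)).
  by congr (_ _); exact: Prop_irrelevance.
by congr (_ _); exact: Prop_irrelevance.
Qed.

Definition dual_zero : dual := (\0 : {linear V -> A^o}).
Definition dual_add (f g : dual) : dual :=
  ((f : {linear V -> A^o}) \+ (g : {linear V -> A^o}) : {linear V -> A^o}).
Definition dual_opp (f : dual) : dual :=
  (\- (f : {linear V -> A^o}) : {linear V -> A^o}).
Definition dual_scale (a : A) (f : dual) : dual :=
  (a \*: (f : {linear V -> A^o}) : {linear V -> A^o}).

Fact dual_addA : associative dual_add.
Proof. by move=> f g h; apply: dual_ext => x; apply: addrA. Qed.
Fact dual_addC : commutative dual_add.
Proof. by move=> f g; apply: dual_ext => x; apply: addrC. Qed.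
Fact dual_add0 : left_id dual_zero dual_add.
Proof. by move=> f; apply: dual_ext => x; apply: add0r. Qed.
Fact dual_addN : left_inverse dual_zero dual_opp dual_add.
Proof. by move=> f; apply: dual_ext => x; apply: addNr. Qed.
HB.instance Definition _ :=
  GRing.isZmodule.Build dual dual_addA dual_addC dual_add0 dual_addN.

Fact dual_scaleA a b f : dual_scale a (dual_scale b f) = dual_scale (a * b) f.
Proof. by apply: dual_ext => x; apply: mulrA. Qed.
Fact dual_scale1 : left_id 1 dual_scale.
Proof. by move=> f; apply: dual_ext => x; apply: mul1r. Qed.
Fact dual_scaleDr : right_distributive dual_scale +%R.
Proof. by move=> a f g; apply: dual_ext => x; apply: mulrDr. Qed.
Fact dual_scaleDl f : {morph dual_scale^~ f : a b / a + b}.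
Proof. by move=> a b; apply: dual_ext => x; apply: mulrDl. Qed.
HB.instance Definition _ := GRing.Zmodule_isLmodule.Build A dual
  dual_scaleA dual_scale1 dual_scaleDr dual_scaleDl.

End Dual.

Section ModuleNotions.
Variables (A : comNzRingType) (V : lmodType A).

Section Biduality.
Variable x : V.

Definition eval_at (f : dual V) : A^o := dual_eval f x.

Fact eval_at_is_linear : linear eval_at.
Proof. by []. Qed.

HB.instance Definition _ :=
  GRing.isLinear.Build A (dual V) A^o *:%R eval_at eval_at_is_linear.

Definition biduality : dual (dual V) := (eval_at : {linear dual V -> A^o}).
End Biduality.

Definition reflexive_module : Prop := bijective biduality.

Definition finitely_generated : Prop :=
  exists (r : nat) (b : 'I_r -> V), forall x, exists c : 'I_r -> A,
    x = \sum_i c i *: b i.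

Definition lin_indep (r : nat) (b : 'I_r -> V) : Prop :=
  forall c : 'I_r -> A, \sum_i c i *: b i = 0 -> forall i, c i = 0.

(** For [A] a domain this is [dim_K (K (x)_A V) = r], [K] the fraction field. *)
Definition has_rank (r : nat) : Prop :=
  (exists b : 'I_r -> V, lin_indep b) /\
  ~ (exists b : 'I_r.+1 -> V, lin_indep b).

End ModuleNotions.

Section DirectSum.
Variables (A : comNzRingType) (m : nat) (V : 'I_m -> lmodType A).

Definition dsum : Type := {dffun forall j, V j}.
HB.instance Definition _ := Choice.on dsum.

Implicit Types x y : dsum.
Definition dsum_zero : dsum := [ffun j => 0 : V j].
Definition dsum_add x y : dsum := [ffun j => x j + y j : V j].
Definition dsum_opp x : dsum := [ffun j => - x j : V j].
Definition dsum_scale (a : A) x : dsum := [ffun j => a *: x j : V j].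

Fact dsum_addA : associative dsum_add.
Proof. by move=> x y z; apply/ffunP => j; rewrite !ffunE addrA. Qed.
Fact dsum_addC : commutative dsum_add.
Proof. by move=> x y; apply/ffunP => j; rewrite !ffunE addrC. Qed.
Fact dsum_add0 : left_id dsum_zero dsum_add.
Proof. by move=> x; apply/ffunP => j; rewrite !ffunE add0r. Qed.
Fact dsum_addN : left_inverse dsum_zero dsum_opp dsum_add.
Proof. by move=> x; apply/ffunP => j; rewrite !ffunE addNr. Qed.
HB.instance Definition _ :=
  GRing.isZmodule.Build dsum dsum_addA dsum_addC dsum_add0 dsum_addN.

Fact dsum_scaleA a b x : dsum_scale a (dsum_scale b x) = dsum_scale (a * b) x.
Proof. by apply/ffunP => j; rewrite !ffunE scalerA. Qed.
Fact dsum_scale1 : left_id 1 dsum_scale.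
Proof. by move=> x; apply/ffunP => j; rewrite !ffunE scale1r. Qed.
Fact dsum_scaleDr : right_distributive dsum_scale +%R.
Proof. by move=> a x y; apply/ffunP => j; rewrite !ffunE scalerDr. Qed.
Fact dsum_scaleDl x : {morph dsum_scale^~ x : a b / a + b}.
Proof. by move=> a b; apply/ffunP => j; rewrite !ffunE scalerDl. Qed.
HB.instance Definition _ := GRing.Zmodule_isLmodule.Build A dsum
  dsum_scaleA dsum_scale1 dsum_scaleDr dsum_scaleDl.

Fact dsum_sumE (I : Type) (r : seq I) (P : pred I) (F : I -> dsum) j :
  (\sum_(i <- r | P i) F i : dsum) j = \sum_(i <- r | P i) F i j.
Proof. by elim/big_rec2: _ => [|i y x _ <-]; rewrite ffunE. Qed.

End DirectSum.

(** The toric variety [Y] of [D] is glued from the charts [U_s = Spec k[s^\vee \cap M]], [s] in the fan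
    [D], with [U_s \cap U_t = U_(s \cap t)], and [U_t] an open subscheme of
    [U_s] when [t] is a face of [s].  An [O_Y]-module is recorded by its
    sections over the charts: a module over the coordinate ring of each [U_s],
    with restriction maps along faces.  Quasi-coherent modules are those for
    which restriction along [U_t \subset U_s] is the localization
    [k[U_t] (x) F(U_s) = F(U_t)]; such data is the same thing as a
    quasi-coherent sheaf on the glued scheme. *)

Section Toric.
Variables (R : realType) (n : nat) (k : fieldType) (D : set (set 'rV[R]_n)).

Local Notation M := 'rV[int]_n.
Local Notation kM := (group_algebra k M).

Definition chart_ring (s : D) : comNzRingType := coord_ring k (val s).

Fact face_dual_cone (s t : set 'rV[R]_n) :
  face t s -> dual_cone s `<=` dual_cone t.
Proof. by case=> u _ -> m sm v [sv _]; apply: sm. Qed.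

Section Inclusion.
Variables (s t : D) (h : face (val t) (val s)).

Fact chart_incl_subproof (a : chart_ring s) : val a \in semigroup_alg k (val t).
Proof.
apply/semigroup_algP => m am; apply: (face_dual_cone h).
by case: a am => f /= /semigroup_algP; apply.
Qed.

Definition chart_incl (a : chart_ring s) : chart_ring t :=
  exist _ (val a) (chart_incl_subproof a).

Fact chart_incl_is_zmod_morphism : zmod_morphism chart_incl.
Proof. by move=> a b; apply: val_inj. Qed.
Fact chart_incl_is_monoid_morphism : monoid_morphism chart_incl.
Proof. by split=> [|a b]; apply: val_inj. Qed.
HB.instance Definition _ := GRing.isZmodMorphism.Build
  (chart_ring s) (chart_ring t) chart_incl chart_incl_is_zmod_morphism.
HB.instance Definition _ := GRing.isMonoidMorphism.Build
  (chart_ring s) (chart_ring t) chart_incl chart_incl_is_monoid_morphism.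
End Inclusion.

Record OYmod := {
  sections :> forall s : D, lmodType (chart_ring s);
  rstr : forall s t : D, face (val t) (val s) -> sections s -> sections t;
  rstrD : forall s t (h : face (val t) (val s)), {morph rstr h : x y / x + y};
  rstrZ : forall s t (h : face (val t) (val s)) (a : chart_ring s) x,
    rstr h (a *: x) = chart_incl h a *: rstr h x;
  rstr_id : forall s (h : face (val s) (val s)) x, rstr h x = x;
  rstr_comp : forall s t r (h : face (val t) (val s)) (h' : face (val r) (val t))
      (h'' : face (val r) (val s)) x,
    rstr h' (rstr h x) = rstr h'' x }.

Definition invertible (A : comNzRingType) (a : A) : Prop := exists b, a * b = 1.

(** [k[U_t]] is the localization of [k[U_s]] at the elements that become
    invertible in [k[U_t]]; [F(U_s) -> F(U_t)] has to be the localization at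
    the same multiplicative set. *)
Definition quasi_coherent (F : OYmod) : Prop :=
  forall (s t : D) (h : face (val t) (val s)),
    (forall y : F t, exists (a : chart_ring s) (x : F s),
       invertible (chart_incl h a) /\ chart_incl h a *: y = rstr h x)
    /\ (forall x : F s, rstr h x = 0 -> exists a : chart_ring s,
       invertible (chart_incl h a) /\ a *: x = 0).

(** [Y] is Noetherian, so coherent means quasi-coherent of finite type. *)
Definition coherent (F : OYmod) : Prop :=
  quasi_coherent F /\ forall s, finitely_generated (F s).

(** The sections of [Hom(F, O_Y)] over a chart form the dual of the module of
    sections of the coherent sheaf [F]. *)
Definition rank_one_reflexive (F : OYmod) : Prop :=
  [/\ coherent F, forall s, reflexive_module (F s)
    & forall s, has_rank (F s) 1].

Record OYhom (F G : OYmod) := {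
  hom_map :> forall s, {linear F s -> G s};
  hom_rstr : forall s t (h : face (val t) (val s)) x,
    hom_map t (rstr h x) = rstr h (hom_map s x) }.

Definition is_OYiso (F G : OYmod) (f : OYhom F G) : Prop :=
  forall s, bijective (f s).

Definition OYiso (F G : OYmod) : Prop := exists f : OYhom F G, is_OYiso f.

(** An [eH]-equivariant [O_Y]-module is an [O_Y]-module whose sections over the
    ([H]-stable) charts are compatibly [p^(-e) M]-graded.  The group
    [p^(-e) M] is identified with [M] by multiplication by [p ^ e]: [gr s d]
    is the component of degree [p^(-e) d], and a section of [O_Y] of degree
    [m \in M] raises the index [d] by [p ^ e m]. *)
Record equivariant (p e : nat) := {
  eqv_mod :> OYmod;
  gr : forall s, M -> set (eqv_mod s);
  gr_0 : forall s d, gr d (0 : eqv_mod s);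
  gr_D : forall s d (x y : eqv_mod s), gr d x -> gr d y -> gr d (x + y);
  gr_Z : forall s m d (a : chart_ring s) (x : eqv_mod s),
    homogeneous m a -> gr d x -> gr (d + m *+ (p ^ e)) (a *: x);
  gr_rstr : forall s t (h : face (val t) (val s)) d (x : eqv_mod s),
    gr d x -> gr d (rstr h x);
  gr_gen : forall s (x : eqv_mod s), exists (l : seq M) (c : M -> eqv_mod s),
    [/\ uniq l, forall d, gr d (c d) & x = \sum_(d <- l) c d];
  gr_free : forall s (l : seq M) (c : M -> eqv_mod s), uniq l ->
    (forall d, gr d (c d)) -> \sum_(d <- l) c d = 0 ->
    forall d, d \in l -> c d = 0 }.

Definition equivariant_iso p e (E E' : equivariant p e) : Prop :=
  exists2 f : OYhom E E', is_OYiso f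
    & forall s d (x : E s), gr d x <-> gr d (f s x).

Section Sum.
Variables (p e m : nat) (N : 'I_m -> equivariant p e).

Definition sum_sections (s : D) : lmodType (chart_ring s) :=
  dsum (fun j => N j s).

Definition sum_rstr (s t : D) (h : face (val t) (val s))
    (x : sum_sections s) : sum_sections t :=
  [ffun j => rstr h ((x : dsum _) j) : N j t].

Fact sum_rstrD s t (h : face (val t) (val s)) :
  {morph sum_rstr h : x y / x + y}.
Proof. by move=> x y; apply/ffunP => j; rewrite !ffunE rstrD. Qed.
Fact sum_rstrZ s t (h : face (val t) (val s)) (a : chart_ring s) x :
  sum_rstr h (a *: x) = chart_incl h a *: sum_rstr h x.
Proof. by apply/ffunP => j; rewrite !ffunE rstrZ. Qed.
Fact sum_rstr_id s (h : face (val s) (val s)) x : sum_rstr h x = x.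
Proof. by apply/ffunP => j; rewrite !ffunE rstr_id. Qed.
Fact sum_rstr_comp s t r (h : face (val t) (val s)) (h' : face (val r) (val t))
    (h'' : face (val r) (val s)) x :
  sum_rstr h' (sum_rstr h x) = sum_rstr h'' x.
Proof. by apply/ffunP => j; rewrite !ffunE (rstr_comp _ _ h''). Qed.

Definition sum_mod : OYmod :=
  Build_OYmod sum_rstrD sum_rstrZ sum_rstr_id sum_rstr_comp.

Definition sum_gr (s : D) (d : M) : set (sum_mod s) :=
  [set x | forall j, gr d ((x : dsum (fun j => N j s)) j)].

Fact sum_gr_0 s d : sum_gr d (0 : sum_mod s).
Proof. by move=> j; rewrite ffunE; apply: gr_0. Qed.
Fact sum_gr_D s d (x y : sum_mod s) : sum_gr d x -> sum_gr d y -> sum_gr d (x + y).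
Proof. by move=> dx dy j; rewrite ffunE; apply: gr_D. Qed.
Fact sum_gr_Z s m' d (a : chart_ring s) (x : sum_mod s) :
  homogeneous m' a -> sum_gr d x -> sum_gr (d + m' *+ (p ^ e)) (a *: x).
Proof. by move=> ma dx j; rewrite ffunE; apply: gr_Z. Qed.
Fact sum_gr_rstr s t (h : face (val t) (val s)) d (x : sum_mod s) :
  sum_gr d x -> sum_gr d (rstr h x).
Proof. by move=> dx j; rewrite ffunE; apply: gr_rstr. Qed.
Fact sum_gr_gen s (x : sum_mod s) : exists (l : seq M) (c : M -> sum_mod s),
  [/\ uniq l, forall d, sum_gr d (c d) & x = \sum_(d <- l) c d].
Proof.
pose xj j := (x : dsum (fun j => N j s)) j.
pose gj j := cid (gr_gen (xj j)).
pose l j := sval (gj j).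
pose c j := sval (cid (svalP (gj j))).
have cP j : [/\ uniq (l j), forall d, gr d (c j d) & xj j = \sum_(d <- l j) c j d].
  exact: (svalP (cid (svalP (gj j)))).
pose L := undup (flatten [seq l j | j <- enum 'I_m]).
have sub j d : d \in l j -> d \in L.
  move=> dl; rewrite mem_undup; apply/flattenP; exists (l j) => //.
  by apply: map_f; rewrite mem_enum.
pose C d : sum_mod s := [ffun j => (if d \in l j then c j d else 0) : N j s].
exists L, C; split; first exact: undup_uniq.
  move=> d j; rewrite ffunE; case: ifP => _; last exact: gr_0.
  by case: (cP j).
apply/ffunP => j; rewrite [RHS]dsum_sumE.
under eq_bigr do rewrite ffunE.
rewrite -big_mkcond /=; case: (cP j) => ul _ xE; rewrite -/(xj j) xE.
rewrite -[RHS]big_filter; apply: perm_big; apply: uniq_perm => //.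
  by rewrite filter_uniq ?undup_uniq.
move=> d; rewrite mem_filter; apply/idP/andP => [dl|[]//].
by split=> //; apply: sub dl.
Qed.
Fact sum_gr_free s (l : seq M) (c : M -> sum_mod s) : uniq l ->
  (forall d, sum_gr d (c d)) -> \sum_(d <- l) c d = 0 ->
  forall d, d \in l -> c d = 0.
Proof.
move=> ul cg c0 d dl; apply/ffunP => j; rewrite [RHS]ffunE.
pose cj d' : N j s := (c d' : dsum (fun j => N j s)) j.
apply: (@gr_free _ _ (N j) s l cj) => // [d'|]; first exact: cg.
by rewrite /cj -dsum_sumE c0 ffunE.
Qed.

Definition equivariant_sum : equivariant p e :=
  Build_equivariant sum_gr_0 sum_gr_D sum_gr_Z sum_gr_rstr sum_gr_gen
    sum_gr_free.
End Sum.

(** Over a chart with coordinate ring [A], [F^e_* O_(eY)] is [A] with [a] acting through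
    multiplication by [a ^+ (p ^ e)], and the monomial [x^d] has degree
    [p^(-e) d]. *)

Section Frobenius.
Variables (p : nat) (hp : p \in [pchar k]) (e : nat).

Definition frob_sections (s : D) : lmodType (chart_ring s) :=
  frob_module (coord_ring_pchar (val s) hp) e.

Definition frob_rstr (s t : D) (h : face (val t) (val s))
    (x : frob_sections s) : frob_sections t := chart_incl h x.

Fact frob_rstrD s t (h : face (val t) (val s)) :
  {morph frob_rstr h : x y / x + y}.
Proof. by move=> x y; apply: val_inj. Qed.
Fact frob_rstrZ s t (h : face (val t) (val s)) (a : chart_ring s) x :
  frob_rstr h (a *: x) = chart_incl h a *: frob_rstr h x.
Proof.
have -> : a *: x = a ^+ (p ^ e) * (x : chart_ring s) by [].
by rewrite /frob_rstr rmorphM rmorphXn.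
Qed.
Fact frob_rstr_id s (h : face (val s) (val s)) x : frob_rstr h x = x.
Proof. exact: val_inj. Qed.
Fact frob_rstr_comp s t r (h : face (val t) (val s)) (h' : face (val r) (val t))
    (h'' : face (val r) (val s)) x :
  frob_rstr h' (frob_rstr h x) = frob_rstr h'' x.
Proof. exact: val_inj. Qed.

Definition frob_mod : OYmod :=
  Build_OYmod frob_rstrD frob_rstrZ frob_rstr_id frob_rstr_comp.

Definition frob_gr (s : D) (d : M) : set (frob_mod s) :=
  [set x | homogeneous d (x : chart_ring s)].

Fact frob_gr_0 s d : frob_gr d (0 : frob_mod s).
Proof. exact: homogeneous0. Qed.
Fact frob_gr_D s d (x y : frob_mod s) : frob_gr d x -> frob_gr d y -> frob_gr d (x + y).
Proof. exact: homogeneousD. Qed.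
Fact frob_gr_Z s m d (a : chart_ring s) (x : frob_mod s) :
  homogeneous m a -> frob_gr d x -> frob_gr (d + m *+ (p ^ e)) (a *: x).
Proof.
rewrite addrC => ma dx.
have -> : a *: x = a ^+ (p ^ e) * (x : chart_ring s) by [].
exact: (homogeneousM (homogeneousX (p ^ e) ma) dx).
Qed.
Fact frob_gr_rstr s t (h : face (val t) (val s)) d (x : frob_mod s) :
  frob_gr d x -> frob_gr d (rstr h x).
Proof. by []. Qed.
Fact frob_gr_gen s (x : frob_mod s) : exists (l : seq M) (c : M -> frob_mod s),
  [/\ uniq l, forall d, frob_gr d (c d) & x = \sum_(d <- l) c d].
Proof. exact: (homogeneous_gen (x : chart_ring s)). Qed.
Fact frob_gr_free s (l : seq M) (c : M -> frob_mod s) : uniq l ->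
  (forall d, frob_gr d (c d)) -> \sum_(d <- l) c d = 0 ->
  forall d, d \in l -> c d = 0.
Proof. exact: (@homogeneous_free _ _ k (val s) l c). Qed.

Definition frob_pushforward : equivariant p e :=
  Build_equivariant frob_gr_0 frob_gr_D frob_gr_Z frob_gr_rstr frob_gr_gen
    frob_gr_free.
End Frobenius.

Definition graded_FFRT_by p (hp : p \in [pchar k]) e0 u
    (Ms : 'I_u -> equivariant p e0) : Prop :=
  (forall l, coherent (Ms l)) /\
  forall e, (1 <= e)%N -> exists (m : nat) (N : 'I_m -> equivariant p e),
    [/\ forall j, coherent (N j),
        equivariant_iso (frob_pushforward hp e) (equivariant_sum N)
      & forall j, exists l, OYiso (N j) (Ms l)].

End Toric.

(* Main.v *)
From HB Require Import structures.
Require Import Defs.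
From mathcomp Require Import all_boot all_order all_algebra finmap.
From mathcomp Require Import boolp classical_sets cardinality reals.
From mathcomp Require Import monalg ring zify.

(** Over a chart with cone [s], the monomials of [F^e_* O_Y] with exponent in a
    fixed coset [d + p^e M] form a summand.  Extracting [p^e]-th roots of the
    coefficients and dividing exponents by [p^e] identifies it with the module
    spanned by the [x^m] with [m + d / p^e] in the dual cone of [s]; this glues,
    and it respects gradings.  The condition on [m] reads [<m, v> + floor(<d, v>
    / p^e) >= 0] for the generators [v] of the cones, and for [d] in the box
    [0 <= d_i < p^e] these floors are bounded independently of [e], so only
    finitely many sheaves occur.  Each is rank-one reflexive: homomorphisms into
    [A = O_Y(U_s)] are multiplications by elements of the group algebra, so the
    bidual is the double colon, which is computed on the facets of the dual cone.
    Finite generation follows from Dickson's lemma applied to the values of [m] on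
    the generators of [s]. *)

Set Implicit Arguments.
Unset Strict Implicit.
Unset Printing Implicit Defensive.

Import Order.TTheory GRing.Theory Num.Theory.
Local Open Scope classical_set_scope.
Local Open Scope ring_scope.

(** * Integral vectors *)

Section IntegerDot.
Variable n : nat.
Implicit Types (u v w a : 'rV[int]_n) (S T : seq 'rV[int]_n).

Definition zdot u v : int := (u *m v^T) 0 0.

Lemma zdotE u v : zdot u v = \sum_i u 0 i * v 0 i.
Proof. by rewrite /zdot mxE; apply: eq_bigr => i _; rewrite mxE. Qed.

Lemma zdotC u v : zdot u v = zdot v u.
Proof. by rewrite !zdotE; apply: eq_bigr => i _; rewrite mulrC. Qed.

Lemma zdotDl u v w : zdot (u + v) w = zdot u w + zdot v w.
Proof. by rewrite /zdot mulmxDl mxE. Qed.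

Lemma zdotNl u w : zdot (- u) w = - zdot u w.
Proof. by rewrite /zdot mulNmx mxE. Qed.

Lemma zdotBl u v w : zdot (u - v) w = zdot u w - zdot v w.
Proof. by rewrite zdotDl zdotNl. Qed.

Lemma zdotZl (c : int) u w : zdot (c *: u) w = c * zdot u w.
Proof. by rewrite /zdot -scalemxAl mxE. Qed.

Lemma zdot0l w : zdot 0 w = 0.
Proof. by rewrite /zdot mul0mx mxE. Qed.

Lemma zdotMnl u w N : zdot (u *+ N) w = zdot u w *+ N.
Proof. by elim: N => [|N IH]; rewrite ?mulr0n ?zdot0l // !mulrS zdotDl IH. Qed.

Lemma zdot_sumr T u : zdot u (\sum_(v <- T) v) = \sum_(v <- T) zdot u v.
Proof.
elim: T => [|v T IH]; first by rewrite !big_nil zdotC zdot0l.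
by rewrite !big_cons -IH !(zdotC u) zdotDl.
Qed.

Lemma zdot_gt0 v : v != 0 -> 0 < zdot v v.
Proof.
move=> v0; rewrite zdotE lt_def sumr_ge0 ?andbT => [|i _]; last exact: sqr_ge0.
apply: contraNneq v0 => /eqP; rewrite psumr_eq0 => [/allP v0|i _]; last exact: sqr_ge0.
apply/eqP/rowP => i; rewrite mxE; apply/eqP.
by have := v0 i (mem_index_enum i); rewrite mulf_eq0 orbb.
Qed.

Lemma mulrn_row_inj (m m' : 'rV[int]_n) (r : nat) : (0 < r)%N -> m *+ r = m' *+ r -> m = m'.
Proof.
move=> r0 /matrixP mm; apply/matrixP => i j; move: (mm i j).
rewrite !mulmxnE => /eqP; rewrite -subr_eq0 -mulrnBl mulrn_eq0 (gtn_eqF r0) /=.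
by rewrite subr_eq0 => /eqP.
Qed.

(** The projection orthogonal to [a], scaled by [zdot a a] to stay integral. *)
Definition zproj a v := zdot a a *: v - zdot v a *: a.

Lemma zdot_proj a u v : zdot (zproj a u) v = zdot u (zproj a v).
Proof.
rewrite zdotBl !zdotZl [RHS]zdotC zdotBl !zdotZl.
by rewrite (zdotC v u) (zdotC a u) (zdotC v a); lia.
Qed.

Lemma zdot_proj0 a u : zdot (zproj a u) a = 0.
Proof. by rewrite zdotBl !zdotZl; lia. Qed.

Lemma zproj_sum a T : \sum_(v <- T) zproj a v =
  zdot a a *: \sum_(v <- T) v - zdot (\sum_(v <- T) v) a *: a.
Proof.
elim: T => [|v T IH]; first by rewrite !big_nil zdot0l scaler0 scale0r subr0.
rewrite !big_cons IH zdotDl scalerDr scalerDl opprD /zproj.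
by rewrite addrACA.
Qed.

Lemma sub_map_preimage (X Y : eqType) (f : X -> Y) (s : seq X) (t : seq Y) :
  {subset t <= map f s} -> exists2 t', {subset t' <= s} & t = map f t'.
Proof.
elim: t => [|y t IH] sub; first by exists [::].
have [|t' st' ->] := IH; first by move=> z zt; apply: sub; rewrite inE zt orbT.
have /mapP[x xs ->] := sub y (mem_head _ _).
by exists (x :: t') => // z; rewrite inE => /predU1P[->|/st'].
Qed.

Lemma exists_large (I : eqType) (s : seq I) (f g : I -> int) :
  (forall i, i \in s -> 0 < f i) ->
  exists N : nat, forall i, i \in s -> 0 < f i *+ N + g i.
Proof.
elim: s => [|i s IH] fs; first by exists 0%N.
have [|N NP] := IH; first by move=> j js; apply: fs; rewrite inE js orbT.
(* By integrality [f i >= 1], so [|g i| + 1] copies of it outweigh [g i]; enlarging [N] only raises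
   the other values. *)
exists (N + `|g i| + 1)%N => j; rewrite inE => /predU1P[->|js].
  by have := fs i (mem_head _ _); move: (f i) (g i) => x y; nia.
have := fs j; rewrite inE js orbT => /(_ isT); have := NP j js.
by move: (f j) (g j) (g i) => x y z; nia.
Qed.

(** Gordan's alternative, with an integral nonnegative relation encoded as a
    multiset with zero sum. *)
Lemma gordan S :
  (exists u, forall v, v \in S -> 0 < zdot u v) \/
  (exists T, [/\ T != [::], {subset T <= S} & \sum_(v <- T) v = 0]).
Proof.
elim: {S}(size S) {-2}S (erefl (size S)) => [|r IH] [|a S] //=.
  by move=> _; left; exists 0.
move=> [sS]; have [->|a0] := eqVneq a 0.
  right; exists [:: 0]; split=> //; last by rewrite big_seq1.
  by move=> v; rewrite !inE => ->.
have na := zdot_gt0 a0.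
have [[u uP]|[U [+ /sub_map_preimage[T TS UT]]]] :=
    IH [seq zproj a v | v <- S] (etrans (size_map _ _) sS).
  left; have [v vS|N NP] := @exists_large _ S (zdot (zproj a u)) (zdot a).
    by rewrite zdot_proj; apply: uP; apply: map_f.
  (* [zproj a u] vanishes on [a] and is positive on [S]. Adding [a] gives the value [zdot a a > 0]
     at [a], and the factor [N] preserves positivity on [S]. *)
  exists (zproj a u *+ N + a) => v; rewrite inE zdotDl zdotMnl => /predU1P[->|/NP//].
  by rewrite zdot_proj0 mul0rn add0r.
rewrite UT => {U UT} T0; have [b bT] : exists b, b \in T.
  by case: T T0 {TS} => // b T _; exists b; rewrite mem_head.
rewrite big_map zproj_sum; set x := \sum_(v <- T) v => /eqP.
rewrite subr_eq0 => /eqP xa.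
have sumn N (U : seq 'rV[int]_n) :
    \sum_(v <- flatten (nseq N U)) v = (\sum_(v <- U) v) *+ N.
  by elim: N => [|N IHN]; rewrite ?big_nil //= big_cat IHN mulrS.
(* The relation among projections reads [(a.a) x = (x.a) a]. If [x.a <= 0], then [a.a] copies of [T]
   together with [-(x.a)] copies of [a] sum to zero. *)
have [le0|gt0] := lerP (zdot x a) 0.
  right; exists (flatten (nseq `|zdot a a| T) ++ flatten (nseq `|zdot x a| [:: a])).
  split.
  - apply: contraTneq bT => /nilP; rewrite /nilp size_cat addn_eq0 => /andP[+ _].
    by case: (zdot a a) na => [[]|] // N _; rewrite /= size_cat addn_eq0 => /andP[/nilP ->].
  - move=> v; rewrite mem_cat inE => /orP[] /flattenP[U /nseqP[-> _]].
      by move=> /TS ->; rewrite orbT.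
    by rewrite inE => ->.
  - rewrite big_cat !sumn big_seq1 -/x -!scaler_nat !natz /= gtz0_abs // lez0_abs //.
    by rewrite xa scaleNr subrr.
(* Now [a] is a positive multiple of the sum [x] of elements of [S], so a functional positive on [S]
   is automatically positive on [a]. *)
have [[u uP]|[U [U0 US sU]]] := IH S sS; last first.
  by right; exists U; split=> // v /US vS; rewrite inE vS orbT.
left; exists u => v; rewrite inE => /predU1P[->|/uP//].
rewrite -(pmulr_rgt0 _ gt0) -[_ * _]mulrC (zdotC u a).
have -> : zdot a u * zdot x a = zdot a a * zdot u x.
  by rewrite (zdotC u x) -(zdotZl (zdot a a)) xa zdotZl mulrC.
rewrite mulr_gt0 // zdot_sumr (big_rem b bT) /= ltr_pwDl ?uP ?TS //.
rewrite big_seq sumr_ge0 // => c /mem_rem cT.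
by rewrite ltW // uP // TS.
Qed.

Definition znonneg S u := forall v, v \in S -> 0 <= zdot u v.

(** Where [u] is positive, a large multiple of it outweighs each [m]; where [u] vanishes, [m] is
    nonnegative by hypothesis. This is the arithmetic behind clearing denominators. *)
Lemma znonneg_push S u (L : seq 'rV[int]_n) : znonneg S u ->
  (forall m v, m \in L -> v \in S -> zdot u v = 0 -> 0 <= zdot m v) ->
  exists N, forall m, m \in L -> znonneg S (u *+ N + m).
Proof.
move=> uS; elim: L => [|m L IH] hL; first by exists 0%N.
have [|N NP] := IH; first by move=> m' v m'L; apply: hL; rewrite inE m'L orbT.
have [v|N' N'P] := @exists_large _ [seq v <- S | 0 < zdot u v] (zdot u) (zdot m).
  by rewrite mem_filter => /andP[].
exists (N + N')%N => m' + v vS; rewrite inE zdotDl zdotMnl => /predU1P[->|m'L].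
  have := uS v vS; rewrite le_eqVlt eq_sym => /predU1P[uv|uv].
    by rewrite uv mul0rn add0r; apply: hL; rewrite ?mem_head.
  have := N'P v; rewrite mem_filter uv vS => /(_ isT).
  by move: (zdot _ _) (zdot _ _) uv => x y; nia.
have := NP m' m'L v vS; rewrite zdotDl zdotMnl.
by have := uS v vS; move: (zdot _ _) (zdot _ _) => x y; nia.
Qed.

(** Induction on the coordinates. Let [B0] serve for the remaining coordinates and let [K] bound
    coordinate [i] on [B0]. Points with [f i x >= K] are dominated through [B0]; those below [K]
    fall into finitely many slices with [f i] constant, each covered by the induction hypothesis. *)
Lemma dickson (X : eqType) (I : Type) (s : seq I) (f : I -> X -> nat) (P : X -> Prop) :
  exists B : seq X, (forall b, b \in B -> P b) /\
    forall x, P x -> exists2 b, b \in B & all (fun i => f i b <= f i x)%N s.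
Proof.
elim: s P => [|i s IH] P.
  have [[x Px]|nP] := pselect (exists x, P x).
    exists [:: x]; split=> [b|y _]; first by rewrite inE => /eqP ->.
    by exists x; rewrite ?mem_head.
  by exists [::]; split=> // x Px; case: nP; exists x.
have [B0 [B0P B0d]] := IH P.
pose K := \max_(b <- B0) f i b.
suff [B1 [B1P B1d]] : exists B : seq X, (forall b, b \in B -> P b) /\
    forall x, P x -> (f i x < K)%N -> exists2 b, b \in B & all (fun j => f j b <= f j x)%N (i :: s).
  exists (B0 ++ B1); split=> [b|x Px]; first by rewrite mem_cat => /orP[/B0P|/B1P].
  have [/(B1d x Px)[b bB bx]|Kx] := ltnP (f i x) K.
    by exists b; rewrite // mem_cat bB orbT.
  have [b bB bx] := B0d x Px; exists b; first by rewrite mem_cat bB.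
  by rewrite /= bx andbT (leq_trans _ Kx) // (leq_bigmax_seq b).
elim: K => [|K [B [BP Bd]]]; first by exists [::].
have [B' [B'P B'd]] := IH (fun x => P x /\ f i x = K).
exists (B ++ B'); split=> [b|x Px]; first by rewrite mem_cat => /orP[/BP|/B'P[]].
rewrite ltnS leq_eqVlt => /predU1P[xK|xK].
  have [b bB bx] := B'd x (conj Px xK); exists b; first by rewrite mem_cat bB orbT.
  by rewrite /= bx (B'P b bB).2 xK leqnn.
by have [b bB bx] := Bd x Px xK; exists b => //; rewrite mem_cat bB.
Qed.

(** Dickson's lemma replaces Gordan's lemma: for [m], [b] in a set bounded below on
    [S], [m - b] is nonnegative on [S] iff the values of [b] are below those of [m]. *)
Lemma znonneg_finite_basis S q d : (0 < q)%N ->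
  exists B : seq 'rV[int]_n, (forall b, b \in B -> znonneg S (b *+ q + d)) /\
    forall m, znonneg S (m *+ q + d) -> exists2 b, b \in B & znonneg S (m - b).
Proof.
move=> q0; have [B [BP Bd]] := dickson S (fun v m => `|zdot (m *+ q + d) v|%N)
  (fun m => znonneg S (m *+ q + d)).
exists B; split=> // m mP; have [b bB /allP bm] := Bd m mP.
exists b => // v vS; have := bm v vS; have := BP b bB v vS; have := mP v vS.
rewrite zdotBl !zdotDl !zdotMnl.
by move: (zdot d v) (zdot m v) (zdot b v) => x y z; nia.
Qed.

End IntegerDot.

(** * Rational cones *)

Section Cones.
Variables (R : realType) (n : nat).
Implicit Types (u v w : 'rV[R]_n) (m x : 'rV[int]_n) (g S T : seq 'rV[int]_n).
Implicit Types s t : set 'rV[R]_n.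
Local Notation lv := (@lattice_vec R n).

Lemma pairing0r u : pairing u 0 = 0.
Proof. by rewrite /pairing trmx0 mulmx0 mxE. Qed.

Lemma pairingDr u v w : pairing u (v + w) = pairing u v + pairing u w.
Proof. by rewrite /pairing linearD mulmxDr mxE. Qed.

Lemma pairingZr u (c : R) v : pairing u (c *: v) = c * pairing u v.
Proof. by rewrite /pairing linearZ -scalemxAr mxE. Qed.

Lemma pairing_lattice m x : pairing (lv m) (lv x) = (zdot m x)%:~R.
Proof. by rewrite /pairing /lattice_vec map_trmx -map_mxM mxE. Qed.

Lemma lattice_vec0 : lv 0 = 0.
Proof. exact: map_mx0. Qed.

Lemma lattice_vecD m x : lv (m + x) = lv m + lv x.
Proof. exact: map_mxD. Qed.

Lemma lattice_vecN m : lv (- m) = - lv m.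
Proof. exact: map_mxN. Qed.

Lemma lattice_vecZ (c : int) m : lv (c *: m) = c%:~R *: lv m.
Proof. exact: map_mxZ. Qed.

Lemma lattice_vec_eq0 m : lv m = 0 -> m = 0.
Proof.
move=> /rowP m0; apply/rowP => i; apply/eqP; have := m0 i.
by rewrite !mxE => /eqP; rewrite intr_eq0.
Qed.

(** Projecting orthogonally to the vectors of [g], one at a time, reduces to empty [g]. There
    Gordan's alternative applies: a nonempty zero-sum multiset from [S] would contradict positivity
    of the real functional [u]. *)
Lemma integral_separator g S u :
  (forall x, x \in g -> pairing u (lv x) = 0) ->
  (forall x, x \in S -> 0 < pairing u (lv x)) ->
  exists m, (forall x, x \in g -> zdot m x = 0) /\
            (forall x, x \in S -> 0 < zdot m x).
Proof.
elim: {g}(size g) {-2}g (erefl (size g)) S => [|r IH] [|a g] //=.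
  move=> _ S _ uS; have [[m mS]|[T [+ + +]]] := gordan S; first by exists m; split.
  case: T => // b T _ TS sT.
  suff : 0 < pairing u (lv (\sum_(x <- b :: T) x)).
    by rewrite sT lattice_vec0 pairing0r ltxx.
  rewrite big_cons lattice_vecD pairingDr ltr_pwDl ?uS ?TS ?mem_head //.
  have {TS}: {subset T <= S} by move=> x xT; rewrite TS // inE xT orbT.
  elim: T {sT} => [|c T IHT] TS; first by rewrite big_nil lattice_vec0 pairing0r.
  rewrite big_cons lattice_vecD pairingDr addr_ge0 //.
    by rewrite ltW // uS // TS // mem_head.
  by apply: IHT => x xT; rewrite TS // inE xT orbT.
move=> [sg] S ug uS; have [a0|a0] := eqVneq a 0.
  have [x xg||m [mg mS]] := IH g sg S; [by apply: ug; rewrite inE xg orbT|by []|].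
  exists m; split=> // x; rewrite inE => /predU1P[->|/mg//].
  by rewrite a0 zdotC zdot0l.
have uproj x : pairing u (lv (zproj a x)) = (zdot a a)%:~R * pairing u (lv x).
  rewrite /zproj lattice_vecD lattice_vecN !lattice_vecZ -scaleNr pairingDr !pairingZr.
  by rewrite (ug a) ?mem_head // mulr0 addr0.
have [_ /mapP[x xg ->]|_ /mapP[x xS ->]|m [mg mS]] :=
  IH [seq zproj a x | x <- g] (etrans (size_map _ _) sg) [seq zproj a x | x <- S].
- by rewrite uproj ug ?mulr0 // inE xg orbT.
- by rewrite uproj mulr_gt0 ?uS // ltr0z zdot_gt0.
exists (zproj a m); split=> x; last by move=> xS; rewrite zdot_proj mS // map_f.
by rewrite inE => /predU1P[->|xg]; rewrite ?zdot_proj0 // zdot_proj mg // map_f.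
Qed.

Lemma cone_span0 g : cone_span g (0 : 'rV[R]_n).
Proof.
by exists (fun _ => 0) => //; rewrite big1 // => i _; rewrite scale0r.
Qed.

Lemma cone_spanD g v w : cone_span g v -> cone_span g w -> cone_span g (v + w).
Proof.
move=> [c c0 ->] [d d0 ->]; exists (fun i => c i + d i) => [i|].
  exact: addr_ge0.
by rewrite -big_split; apply: eq_bigr => i _; rewrite scalerDl.
Qed.

Lemma cone_spanZ g (a : R) v : 0 <= a -> cone_span g v -> cone_span g (a *: v).
Proof.
move=> a0 [c c0 ->]; exists (fun i => a * c i) => [i|]; first exact: mulr_ge0.
by rewrite scaler_sumr; apply: eq_bigr => i _; rewrite scalerA.
Qed.

Lemma cone_span_gen g x : x \in g -> cone_span g (lv x).
Proof.
rewrite -index_mem => xi; pose i0 := Ordinal xi.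
exists (fun i => (i == i0)%:R) => [i|]; first exact: ler0n.
rewrite (bigD1 i0) //= eqxx scale1r big1 => [|i /negPf->]; last by rewrite scale0r.
by rewrite addr0 (tnth_nth 0) /= nth_index // -index_mem.
Qed.

Lemma cone_span_sum g T : {subset T <= g} -> cone_span g (lv (\sum_(x <- T) x)).
Proof.
elim: T => [|x T IH] Tg; first by rewrite big_nil lattice_vec0; apply: cone_span0.
rewrite big_cons lattice_vecD; apply: cone_spanD.
  by apply: cone_span_gen; rewrite Tg ?mem_head.
by apply: IH => y yT; rewrite Tg // inE yT orbT.
Qed.

Lemma cone_span_min g (K : set 'rV[R]_n) : K 0 ->
  (forall v w, K v -> K w -> K (v + w)) ->
  (forall (a : R) v, 0 <= a -> K v -> K (a *: v)) ->
  (forall x, x \in g -> K (lv x)) -> cone_span g `<=` K.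
Proof.
move=> K0 KD KZ Kg v [c c0 ->]; elim/big_rec: _ => [|i w _ Kw] //.
by apply: KD => //; apply: KZ => //; apply: Kg; exact: mem_tnth.
Qed.

Lemma dual_cone_span g m : dual_cone (cone_span (R:=R) g) m <-> znonneg g m.
Proof.
split=> [mg x /cone_span_gen/mg|mg]; first by rewrite pairing_lattice ler0z.
apply: cone_span_min => [|v w|a v|x xg].
- by rewrite pairing0r.
- by rewrite pairingDr; apply: addr_ge0.
- by rewrite pairingZr; apply: mulr_ge0.
- by rewrite pairing_lattice ler0z mg.
Qed.

(** The second condition makes every vector of [g] span an extremal ray. *)
Definition ray_generators g :=
  (exists u : 'rV[int]_n, forall x, x \in g -> 0 < zdot u x) /\
  (forall x, x \in g -> exists2 u : 'rV[int]_n, zdot u x = 0 &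
    forall y, y \in g -> y != x -> 0 < zdot u y).

(** A generating sequence of minimal length works: by Gordan's alternative for the
    projections of the other generators orthogonal to [x], either there is a
    functional vanishing exactly on [x], or [x] is superfluous, or the cone
    contains a line. *)
Lemma ray_generatorsP s : is_cone s ->
  exists2 g, s = cone_span g & ray_generators g.
Proof.
case=> [[g0 sg0] pointed].
have ex : exists r, `[< exists2 g, s = cone_span g & size g = r >].
  by exists (size g0); apply/asboolP; exists g0.
case: (ex_minnP ex) => r /asboolP[g sg gr] rmin; exists g => //.
have drop x : x \in g -> ~ cone_span [seq y <- g | y != x] (lv x).
  move=> xg xs; suff /rmin : `[< exists2 g', s = cone_span g' & size g' =
      size [seq y <- g | y != x] >].
    rewrite -gr size_filter -(count_predC (pred1 x)) -[leqRHS]add0n leq_add2r.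
    by rewrite leqn0 -leqn0 leqNgt -has_count has_pred1 xg.
  apply/asboolP; exists [seq y <- g | y != x] => //.
  rewrite sg; apply/seteqP; split; apply: cone_span_min => //.
  - exact: cone_span0.
  - exact: cone_spanD.
  - exact: cone_spanZ.
  - move=> y yg; have [->//|yx] := eqVneq y x.
    by apply: cone_span_gen; rewrite mem_filter yx.
  - exact: cone_span0.
  - exact: cone_spanD.
  - exact: cone_spanZ.
  - by move=> y; rewrite mem_filter => /andP[_ /cone_span_gen].
have g0' : 0 \notin g.
  by apply/negP => /drop; apply; rewrite lattice_vec0; apply: cone_span0.
have pos x (a : R) : x \in g -> 0 < a -> ~ s (- (a *: lv x)).
  move=> xg a0 Nx; have /eqP : a *: lv x = 0.
    apply: pointed => //; rewrite sg; apply: cone_spanZ (ltW a0) _.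
    exact: cone_span_gen.
  rewrite scaler_eq0 gt_eqF //= => /eqP/lattice_vec_eq0 x0.
  by rewrite -x0 xg in g0'.
split=> [|x xg].
  have [//|[[|b T] [//= _ TS]]] := gordan g.
  rewrite big_cons => /eqP; rewrite addrC addr_eq0 => /eqP sT.
  case: (@pos b 1); rewrite ?TS ?mem_head // scale1r -lattice_vecN -sT sg.
  by apply: cone_span_sum => y yT; rewrite TS // inE yT orbT.
have [[u uP]|[U [+ /sub_map_preimage[T TS UT]]]] :=
    gordan [seq zproj x y | y <- g & y != x].
  exists (zproj x u) => [|y yg yx]; first exact: zdot_proj0.
  by rewrite zdot_proj uP // map_f // mem_filter yx.
have Tg : {subset T <= g} by move=> y /TS; rewrite mem_filter => /andP[].
have x0 : x != 0 by apply: contraNneq g0' => <-.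
rewrite UT big_map zproj_sum => {U UT} T0 /eqP; rewrite subr_eq0 => /eqP/(congr1 lv).
rewrite !lattice_vecZ; set N := zdot x x; set l := zdot _ x => NT.
have N0 : 0 < (N%:~R : R) by rewrite ltr0z zdot_gt0.
(* With [X] the sum of [T], the relation is [N X = l x]. For [l <= 0] it puts [-N b] in the cone for
   any [b] in [T]; for [l > 0] it writes [x] through the other generators. *)
have [le0|gt0] := lerP l 0.
  have [b bT] : exists b, b \in T.
    by case: (T) T0 => // b T' _; exists b; rewrite mem_head.
  case: (@pos b _ (Tg _ bT) N0).
  have -> : - (N%:~R *: lv b) =
      N%:~R *: lv (\sum_(y <- rem b T) y) + (- l)%:~R *: lv x.
    move: NT; rewrite (big_rem b bT) /= lattice_vecD scalerDr => NT.
    by apply/eqP; rewrite eqr_oppLR opprD addrC intrN scaleNr opprK -NT addrK.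
  rewrite sg; apply: cone_spanD; apply: cone_spanZ.
  - exact: ltW.
  - by apply: cone_span_sum => y /mem_rem; apply: Tg.
  - by rewrite ler0z oppr_ge0.
  - exact: cone_span_gen.
case: (drop x xg); have l0 : 0 < (l%:~R : R) by rewrite ltr0z.
have -> : lv x = (N%:~R / l%:~R) *: lv (\sum_(y <- T) y).
  by rewrite mulrC -scalerA NT scalerA mulVf ?scale1r // gt_eqF.
apply: cone_spanZ (cone_span_sum TS).
by rewrite divr_ge0 ?ltW.
Qed.

(** Faces are cut out by real functionals, but exponents of monomials are integral.
    [integral_separator] yields an integral functional vanishing on the same generators, and a point
    of the face is a nonnegative combination of those generators only. *)
Lemma face_separator g t : face t (cone_span g) -> exists u : 'rV[int]_n,
  [/\ znonneg g u, forall v, t v -> pairing (lv u) v = 0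
    & forall x, x \in g -> zdot u x = 0 -> t (lv x)].
Proof.
case=> u unn ->.
have [x|x|m [m0 mpos]] := @integral_separator
    [seq x <- g | pairing u (lv x) == 0] [seq x <- g | pairing u (lv x) != 0] u.
- by rewrite mem_filter => /andP[/eqP].
- rewrite mem_filter => /andP[ux xg].
  by rewrite lt_def ux unn //; apply: cone_span_gen.
have mg x : x \in g -> zdot m x = 0 <-> pairing u (lv x) = 0.
  move=> xg; split=> [mx|ux]; last by apply: m0; rewrite mem_filter ux eqxx.
  apply/eqP/negPn/negP => ux.
  by have := mpos x; rewrite mem_filter ux xg mx ltxx => /(_ isT).
exists m; split.
- move=> x xg; have [/(mg x xg)-> //|ux] := eqVneq (pairing u (lv x)) 0.
  by rewrite ltW // mpos // mem_filter ux.
- move=> _ [[c c0 ->] ].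
  have tg i : tnth (in_tuple g) i \in g by exact: mem_tnth.
  have sumr w : pairing w (\sum_i c i *: lv (tnth (in_tuple g) i)) =
      \sum_i c i * pairing w (lv (tnth (in_tuple g) i)).
    rewrite (big_morph (pairing w) (pairingDr w) (pairing0r w)).
    by apply: eq_bigr => i _; rewrite pairingZr.
  rewrite !sumr => /eqP; rewrite psumr_eq0 => [/allP cu|i _]; last first.
    by rewrite mulr_ge0 // unn //; apply/cone_span_gen/tg.
  rewrite big1 // => i _; have := cu i (mem_index_enum i).
  rewrite mulf_eq0 => /orP[/eqP->|/eqP ui]; first by rewrite mul0r.
  by rewrite pairing_lattice (mg _ (tg i)).2 // mulr0.
- by move=> x xg /(mg x xg); split=> //; apply: cone_span_gen.
Qed.

Lemma dual_coneMn s m N : dual_cone s m -> dual_cone s (m *+ N).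
Proof.
move=> sm; elim: N => [|N IH]; rewrite ?mulr0n ?mulrS; first exact: dual_cone0.
exact: dual_coneD.
Qed.

(** In terms of charts, [x^u] is regular on the chart of the cone, invertible on that of its face
    [t], and multiplies finitely many sections over the face back to sections over the whole
    chart. *)
Lemma face_push g t q (d : 'rV[int]_n) (L : seq 'rV[int]_n) : (0 < q)%N ->
  face t (cone_span g) -> (forall m, m \in L -> dual_cone t (m *+ q + d)) ->
  exists u : 'rV[int]_n, [/\ dual_cone (cone_span (R:=R) g) u, dual_cone t (- u)
    & forall m, m \in L -> dual_cone (cone_span (R:=R) g) ((u + m) *+ q + d)].
Proof.
move=> q0 /face_separator[u [ug ut tu]] Lt.
have [|N NP] := znonneg_push (L := [seq m *+ q + d | m <- L]) ug.
  move=> _ x /mapP[m mL ->] xg /(tu x xg) tx.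
  by have := Lt m mL _ tx; rewrite pairing_lattice ler0z.
have su : dual_cone (cone_span (R:=R) g) u by apply/dual_cone_span.
exists (u *+ N); split.
- exact: dual_coneMn.
- move=> v tv; rewrite -mulNrn /pairing /lattice_vec.
  rewrite -[map_mx _ _]/(lv _) -scaler_nat natz lattice_vecZ lattice_vecN.
  by rewrite -scalemxAl mulNmx mxE mxE [X in - X](ut v tv) oppr0 mulr0.
- move=> m mL; case: q q0 {Lt} NP => // q _ NP.
  (* One copy of [u *+ N] already makes the shifted exponent nonnegative; the remaining copies lie
     in the dual cone. *)
  have -> : (u *+ N + m) *+ q.+1 + d = u *+ N *+ q + (u *+ N + (m *+ q.+1 + d)).
    by rewrite mulrnDl mulrSr -!addrA.
  apply: dual_coneD; first by do 2 apply: dual_coneMn.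
  by apply/dual_cone_span/NP/map_f.
Qed.

End Cones.

(** * Modules spanned by monomials *)

Section GroupAlgebraTheory.
Variables (k : comNzRingType) (M : zmodType).
Implicit Types (f g h : group_algebra k M) (m : M) (c : k).

Lemma ga_monomM c d m m' :
  ga_monom c m * ga_monom d m' = ga_monom (c * d) (m + m').
Proof. exact: ga_mulUU. Qed.

Lemma ga_monomX c m N : ga_monom c m ^+ N = ga_monom (c ^+ N) (m *+ N).
Proof. by elim: N => // N IH; rewrite !exprS IH ga_monomM -mulrS. Qed.

Lemma ga_monomE f : f = \sum_(m <- msupp f) ga_monom f@_m m.
Proof. exact: monalgE. Qed.

Lemma ga_ind (Q : group_algebra k M -> Prop) : Q 0 ->
  (forall f g, Q f -> Q g -> Q (f + g)) -> (forall c m, Q (ga_monom c m)) ->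
  forall f, Q f.
Proof.
by move=> Q0 QD Qm f; rewrite (ga_monomE f); elim/big_rec: _ => // m g _; apply: QD.
Qed.

Lemma mcoeff_monom c m m' : (ga_monom c m)@_m' = c *+ (m == m').
Proof. exact: mcoeffU. Qed.

Lemma mcoeff_monomM c m f m' : (ga_monom c m * f)@_m' = c * f@_(m' - m).
Proof.
elim/ga_ind: f m' => [|f g IHf IHg|d m1] m'.
- by rewrite mulr0 !mcoeff0 mulr0.
- by rewrite mulrDr !mcoeffD IHf IHg mulrDr.
- by rewrite ga_monomM !mcoeff_monom mulrnAr [in RHS]eq_sym subr_eq eq_sym addrC.
Qed.

Lemma monom_inj m f g : ga_monom 1 m * f = ga_monom 1 m * g -> f = g.
Proof.
move=> /(congr1 ( *%R (ga_monom 1 (- m)))); rewrite !mulrA ga_monomM mulr1 addNr.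
by rewrite -[ga_monom 1 0]/(1 : group_algebra k M) !mul1r.
Qed.

Lemma monom_mul_eq0 m f : ga_monom 1 m * f = 0 -> f = 0.
Proof. by move=> f0; apply: (@monom_inj m); rewrite f0 mulr0. Qed.

Lemma mcoeffM_neq0 f g m : (f * g)@_m != 0 ->
  exists m1 m2, [/\ f@_m1 != 0, g@_m2 != 0 & m = m1 + m2].
Proof.
rewrite {1}(ga_monomE f) mulr_suml raddf_sum /= => fg; apply: contrapT => nm.
case/eqP: fg; rewrite big_seq big1 // => m1 m1f; rewrite mcoeff_monomM.
have [-> |gm] := eqVneq (g@_(m - m1)) 0; first by rewrite mulr0.
case: nm; exists m1, (m - m1); split=> //; first by rewrite mcoeff_neq0.
by rewrite addrC subrK.
Qed.

Definition supported_on (P : set M) : {pred group_algebra k M} :=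
  [pred f | `[< forall m, f@_m != 0 -> P m >]].

Lemma supported_onP (P : set M) f :
  reflect (forall m, f@_m != 0 -> P m) (f \in supported_on P).
Proof. exact: asboolP. Qed.

Lemma supported_on_zmod (P : set M) : zmod_closed (supported_on P).
Proof.
split=> [|f g /supported_onP fP /supported_onP gP]; apply/supported_onP => m.
  by rewrite mcoeff0 eqxx.
rewrite mcoeffB => fg; have [fm|/fP//] := eqVneq (f@_m) 0; apply: gP.
by apply: contraNneq fg => ->; rewrite fm subr0.
Qed.

HB.instance Definition _ P := GRing.isZmodClosed.Build (group_algebra k M)
  (supported_on P) (supported_on_zmod P).

Lemma monom_supported (P : set M) c m : P m -> ga_monom c m \in supported_on P.
Proof.
move=> Pm; apply/supported_onP => m'; rewrite mcoeff_monom.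
by have [<- _|_] := eqVneq m m'; last by rewrite eqxx.
Qed.

Lemma supported_onM (P Q S : set M) f g :
  (forall m m', P m -> Q m' -> S (m + m')) ->
  f \in supported_on P -> g \in supported_on Q -> f * g \in supported_on S.
Proof.
move=> PQS /supported_onP fP /supported_onP gQ; apply/supported_onP => m.
by move=> /mcoeffM_neq0[m1 [m2 [/fP ? /gQ ? ->]]]; apply: PQS.
Qed.

End GroupAlgebraTheory.

Arguments supported_on k {M} P.

Lemma rank_one_pair (A : comNzRingType) (V : lmodType A) (b : 'I_2 -> V) (c d : A) :
  lin_indep b -> c *: b ord0 + d *: b ord_max = 0 -> c = 0 /\ d = 0.
Proof.
move=> bi cd; pose F (i : 'I_2) := if i == ord0 then c else d.
have F0 : \sum_i F i *: b i = 0.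
  rewrite !big_ord_recl big_ord0 addr0 /F /=.
  by rewrite (_ : lift ord0 ord0 = ord_max) //; apply: val_inj.
by split; [exact: (bi F F0 ord0)|exact: (bi F F0 ord_max)].
Qed.

Lemma inj_surj_bijective (X Y : Type) (f : X -> Y) :
  injective f -> (forall y, exists x, f x = y) -> bijective f.
Proof. by move=> fi /boolp.choice[g gK]; exists g => // x; apply: fi. Qed.

Lemma dual_evalZ (A : comNzRingType) (V : lmodType A) (f : dual V) a x :
  dual_eval f (a *: x) = a * dual_eval f x.
Proof. by rewrite /dual_eval linearZ. Qed.

Section MonomialModule.
Variables (R : realType) (n : nat) (k : comNzRingType) (s : set 'rV[R]_n).
Local Notation M := 'rV[int]_n.
Local Notation kM := (group_algebra k M).
Local Notation A := (coord_ring k s).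

Definition stable (P : set M) := forall m m', dual_cone s m -> P m' -> P (m + m').

Lemma supported_dual_cone (f : kM) :
  (f \in semigroup_alg k s) = (f \in supported_on k (dual_cone s)).
Proof. exact: (sameP (semigroup_algP _ f) (supported_onP _ f)). Qed.

Definition ring_elt (f : kM) (fA : f \in semigroup_alg k s) : A := exist _ f fA.

Definition monom_in m (sm : dual_cone s m) : A :=
  ring_elt (etrans (supported_dual_cone _) (monom_supported 1 sm)).

Section Def.
Variables (P : set M) (hP : stable P).

(** The proof of stability is a parameter of the type, so that the module structure, which depends
    on it, can be inferred. *)
Definition monomial_module of stable P : Type := {f : kM | f \in supported_on k P}.
Local Notation V := (monomial_module hP).
HB.instance Definition _ := [isSub of V for @sval _ _].
HB.instance Definition _ := [Choice of V by <:].
HB.instance Definition _ := [SubChoice_isSubZmodule of V by <:].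

Fact mscale_subproof (a : A) (x : V) : val a * val x \in supported_on k P.
Proof.
by apply: supported_onM hP _ (valP x); rewrite -supported_dual_cone (valP a).
Qed.
Definition mscale (a : A) (x : V) : V := exist _ (val a * val x) (mscale_subproof a x).

Fact mscaleA a b x : mscale a (mscale b x) = mscale (a * b) x.
Proof. by apply: val_inj; rewrite /= mulrA. Qed.
Fact mscale1 : left_id 1 mscale.
Proof. by move=> x; apply: val_inj; rewrite /= mul1r. Qed.
Fact mscaleDr : right_distributive mscale +%R.
Proof. by move=> a x y; apply: val_inj; rewrite /= mulrDr. Qed.
Fact mscaleDl x : {morph mscale^~ x : a b / a + b}.
Proof. by move=> a b; apply: val_inj; rewrite /= mulrDl. Qed.
HB.instance Definition _ := GRing.Zmodule_isLmodule.Build A V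
  mscaleA mscale1 mscaleDr mscaleDl.

Definition module_elt (f : kM) (fP : f \in supported_on k P) : V := exist _ f fP.

Definition monom_mod (c : k) m (Pm : P m) : V := module_elt (monom_supported c Pm).

Lemma monomial_module_ind (Q : V -> Prop) : Q 0 ->
  (forall x y, Q x -> Q y -> Q (x + y)) ->
  (forall c m (Pm : P m), Q (monom_mod c Pm)) -> forall x, Q x.
Proof.
move=> Q0 QD Qm [f fP].
suff : forall L : seq M, (forall m, m \in L -> f@_m != 0) ->
    exists2 x : V, val x = \sum_(m <- L) ga_monom f@_m m & Q x.
  case/(_ (msupp f)) => [m|x xE Qx]; first by rewrite mcoeff_neq0.
  by rewrite (_ : exist _ _ _ = x) //; apply: val_inj; rewrite xE [LHS]ga_monomE.
elim=> [|m L IH] Lf; first by exists 0; rewrite ?big_nil.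
have [m' m'L|x xE Qx] := IH; first by apply: Lf; rewrite inE m'L orbT.
have Pm : P m by move/supported_onP: (fP); apply; apply: Lf; rewrite mem_head.
exists (monom_mod f@_m Pm + x); first by rewrite big_cons -xE.
by apply: QD.
Qed.

Lemma monomial_module_fg (B : seq M) : (forall b, b \in B -> P b) ->
  (forall m, P m -> exists2 b, b \in B & dual_cone s (m - b)) ->
  finitely_generated V.
Proof.
move=> BP Bgen; have BPi (i : 'I_(size B)) : P (tnth (in_tuple B) i).
  by apply: BP; exact: mem_tnth.
exists (size B), (fun i => monom_mod 1 (BPi i)); elim/monomial_module_ind.
- by exists (fun _ => 0); rewrite big1 // => i _; rewrite scale0r.
- move=> x y [c ->] [d ->]; exists (fun i => c i + d i).
  by rewrite -big_split; apply: eq_bigr => i _; rewrite scalerDl.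
- move=> c m Pm; have [b bB mb] := Bgen m Pm.
  have bi : (index b B < size B)%N by rewrite index_mem.
  have cA : ga_monom c (m - b) \in semigroup_alg k s.
    by rewrite supported_dual_cone monom_supported.
  exists (fun i => if i == Ordinal bi then ring_elt cA else 0).
  rewrite (bigD1 (Ordinal bi)) //= eqxx big1 => [|i /negPf->]; last by rewrite scale0r.
  have tb : tnth (in_tuple B) (Ordinal bi) = b by rewrite (tnth_nth 0) /= nth_index.
  rewrite addr0; apply: val_inj.
  transitivity (ga_monom c (m - b) * ga_monom 1 (tnth (in_tuple B) (Ordinal bi)) : kM).
    by rewrite tb ga_monomM mulr1 subrK.
  by [].
Qed.

End Def.

Variables (P : set M) (hP : stable P).
Local Notation V := (monomial_module hP).

(** Every fractional ideal can be moved into [A] by a monomial. *)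
Definition clearable :=
  forall L : seq M, exists2 u, dual_cone s u & forall m, m \in L -> dual_cone s (u + m).

Hypothesis clear : clearable.

Lemma clear_elt (f : kM) : exists2 u, dual_cone s u & ga_monom 1 u * f \in semigroup_alg k s.
Proof.
have [u su uP] := clear (msupp f); exists u => //; apply/semigroup_algP => m.
rewrite mcoeff_monomM mul1r mcoeff_neq0 => /uP; by rewrite addrC subrK.
Qed.

(** Monomials are units of [kM], so one monomial is independent. Two elements [f], [g] satisfy
    [(x^u x^v g) f = (x^v x^u f) g], where [u] and [v] bring the coefficients into [A]. Independence
    then forces [f = 0], which is itself a dependence. *)
Lemma monomial_module_rank : P !=set0 -> has_rank V 1.
Proof.
move=> [m Pm]; split.
  exists (fun _ => monom_mod hP 1 Pm) => c; rewrite big_ord_recl big_ord0 addr0.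
  move=> /(congr1 val); rewrite raddf0 /= mulrC => c0 i; rewrite ord1.
  by apply: val_inj; rewrite raddf0; apply: (@monom_mul_eq0 _ _ m).
case=> b bi; have [u su bu] := clear_elt (val (b ord0)).
have [v sv bv] := clear_elt (val (b ord_max)).
have [|_ d0] := @rank_one_pair _ _ _ (monom_in su * ring_elt bv)
    (- (monom_in sv * ring_elt bu)) bi.
  have relation (B : comNzRingType) (x y f g : B) :
      x * (y * g) * f - y * (x * f) * g = 0 by ring.
  by apply: val_inj; rewrite scaleNr raddfB raddf0; exact: (@relation kM).
have b0 : b ord0 = 0.
  apply: val_inj; rewrite raddf0; apply: (@monom_mul_eq0 _ _ u).
  by apply: (@monom_mul_eq0 _ _ v); move: d0 => /(congr1 (fun a => val (- a)));
    rewrite opprK oppr0 raddf0.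
have [|/eqP] := @rank_one_pair _ _ _ 1 0 bi; first by rewrite b0 scaler0 scale0r addr0.
by rewrite oner_eq0.
Qed.

(** A homomorphism is determined by its value on one monomial [x^m], because every
    element has a multiple by some [x^u] that is an [A]-multiple of [x^m]. *)
Lemma dual_mult : P !=set0 -> forall phi : dual V,
  exists g : kM, forall x, val (dual_eval phi x) = g * val x.
Proof.
move=> [m Pm] phi; pose e := monom_mod hP 1 Pm.
exists (ga_monom 1 (- m) * val (dual_eval phi e)) => x.
have [u su xu] := clear_elt (ga_monom 1 (- m) * val x).
have m1 : ga_monom 1 (- m) * ga_monom 1 m = 1 :> kM.
  by rewrite ga_monomM mulr1 addNr.
apply: (@monom_inj _ _ u); transitivity (val (dual_eval phi (monom_in su *: x))).
  by rewrite dual_evalZ.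
have -> : monom_in su *: x = ring_elt xu *: e.
  have assoc (B : comNzRingType) (a b c f : B) : b * c = 1 ->
    a * f = a * (b * f) * c by move=> bc; rewrite -[LHS]mulr1 -bc; ring.
  by apply: val_inj; exact: (@assoc kM).
have assoc (B : comNzRingType) (a b c f : B) : a * (b * f) * c = a * (b * c * f) by ring.
by rewrite dual_evalZ; exact: (@assoc kM).
Qed.

(** The exponents of the fractional ideal of multipliers that carry the span of the monomials from
    [Q] into [A]. *)
Definition colon (Q : set M) : set M :=
  [set m | forall m', Q m' -> dual_cone s (m + m')].

Lemma colon_stable Q : stable (colon Q).
Proof.
by move=> m m' sm Qm' m'' Qm''; rewrite -addrA; apply: dual_coneD => //; apply: Qm'.
Qed.

End MonomialModule.

(** * Duals of monomial modules as colon modules *)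

Section Reflexivity.
Variables (R : realType) (n : nat) (k : comNzRingType) (s : set 'rV[R]_n).
Local Notation M := 'rV[int]_n.
Local Notation kM := (group_algebra k M).
Local Notation A := (coord_ring k s).
Variables (P : set M) (hP : stable s P).
Local Notation V := (monomial_module k hP).
Local Notation W := (monomial_module k (colon_stable (s:=s) (Q:=P))).

Fact colon_mul_subproof (g : W) (x : V) : val g * val x \in semigroup_alg k s.
Proof.
rewrite supported_dual_cone; apply: supported_onM (valP g) (valP x) => m m'.
exact.
Qed.

Definition colon_mul (g : W) (x : V) : A^o := ring_elt (colon_mul_subproof g x).

Fact colon_mul_linear g : linear (colon_mul g).
Proof. by move=> a x y; apply: val_inj; rewrite /= mulrDr mulrCA. Qed.
HB.instance Definition _ g := GRing.isLinear.Build A V A^o *:%R (colon_mul g)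
  (colon_mul_linear g).

Definition colon_dual (g : W) : dual V := (colon_mul g : {linear V -> A^o}).

Fact colon_dual_linear : linear colon_dual.
Proof.
move=> a g h; apply: dual_ext => x; apply: val_inj.
by rewrite /= mulrDl mulrA.
Qed.
HB.instance Definition _ := GRing.isLinear.Build A W (dual V) *:%R colon_dual
  colon_dual_linear.

Hypotheses (clear : clearable s) (P0 : P !=set0).

(** The multiplier [g] is tested on the monomials [x^m'] with [m'] in [P]: its coefficient at [m]
    reappears at [m + m'] in a value lying in [A]. *)
Lemma colon_dual_surj (phi : dual V) : exists g, colon_dual g = phi.
Proof.
have [g gE] := dual_mult clear P0 phi.
suff gP : g \in supported_on k (colon s P).
  by exists (module_elt _ gP); apply: dual_ext => x; apply: val_inj; rewrite gE.
apply/supported_onP => m gm m' Pm'.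
have /semigroup_algP := valP (dual_eval phi (monom_mod hP 1 Pm')).
apply; rewrite gE mulrC mcoeff_monomM mul1r addrK.
by [].
Qed.

End Reflexivity.

(** Injectivity is seen on multiplication by a single monomial [x^m0] of the colon. For
    surjectivity, [Phi] composed with [colon_dual] is a functional on the colon module, hence
    multiplication by an element supported on the double colon, that is, on [P]. *)
Lemma monomial_module_reflexive (R : realType) (n : nat) (k : comNzRingType)
    (s : set 'rV[R]_n) (P : set 'rV[int]_n) (hP : stable s P) :
  clearable s -> P !=set0 -> colon s P !=set0 -> colon s (colon s P) `<=` P ->
  reflexive_module (monomial_module k hP).
Proof.
move=> clear P0 [m0 cm0] ccP.
apply: inj_surj_bijective => [x y xy|Phi].
  have mP := monom_supported (1 : k) cm0.
  have := congr1 (fun F => val (dual_eval F (colon_dual hP (module_elt _ mP)))) xy.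
  by move=> e; apply: val_inj; exact: (monom_inj e).
pose psi : dual (monomial_module k (colon_stable (s:=s) (Q:=P))) :=
  ((Phi : {linear _ -> _}) \o @colon_dual _ _ k s P hP : {linear _ -> _}).
have [h hE] := colon_dual_surj clear (ex_intro _ m0 cm0) psi.
have hV : val h \in supported_on k P.
  apply/supported_onP => m hm; apply: ccP.
  exact: (elimT (supported_onP _ _) (valP h)).
exists (module_elt hP hV); apply: dual_ext => phi.
have [g <-] := colon_dual_surj clear P0 phi; apply: val_inj.
have := congr1 (fun F => val (dual_eval F g)) hE => /= <-.
by rewrite mulrC.
Qed.

(** * Exponent sets cut out by shifted dual cones *)

Section ShiftedDualCone.
Variables (R : realType) (n : nat).
Local Notation M := 'rV[int]_n.
Implicit Types (s : set 'rV[R]_n) (q : nat) (d m : M).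

(** The exponents [m] with [m + d / q] in the dual cone. *)
Definition shifted_dual s q d : set M := [set m | dual_cone s (m *+ q + d)].

Lemma shifted_dual_stable s q d : stable s (shifted_dual s q d).
Proof.
move=> m m' sm sm'; rewrite /shifted_dual /= mulrnDl -addrA.
by apply: dual_coneD => //; apply: dual_coneMn.
Qed.

Lemma exists_min (I : eqType) (r : seq I) (f : I -> int) i0 : i0 \in r ->
  exists2 i, i \in r & forall j, j \in r -> f i <= f j.
Proof.
elim: r i0 => // i [|j r] IH i0 _.
  by exists i => [|j]; rewrite ?mem_head // inE => /eqP ->.
have [l lr lmin] := IH j (mem_head _ _).
have [il|/ltW li] := lerP (f i) (f l).
  exists i => [|j']; first by rewrite mem_head.
  by rewrite inE => /predU1P[->//|/lmin]; apply: le_trans.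
by exists l => [|j']; rewrite inE ?lr ?orbT // => /predU1P[->|/lmin].
Qed.

Variable s : set 'rV[R]_n.
Hypothesis hs : is_cone s.

(** Since the cone is pointed, some exponent is strictly positive on all its ray generators, and a
    large multiple of it dominates any finite list. *)
Lemma cone_clearable : clearable s.
Proof.
have [g -> [[u ug] _]] := ray_generatorsP hs; move=> L.
have [||N NP] := @znonneg_push _ g u L.
- by move=> x /ug/ltW.
- by move=> m x _ /ug + ux; rewrite ux ltxx.
exists (u *+ N) => [|m /NP]; last by move/dual_cone_span.
by apply/dual_cone_span => x xg; rewrite zdotMnl mulrn_wge0 // ltW // ug.
Qed.

Variables (q : nat) (d : M).
Hypothesis q0 : (0 < q)%N.
Local Notation P := (shifted_dual s q d).

Lemma shifted_dual_neq0 : P !=set0.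
Proof.
have [u su ud] := cone_clearable [:: d]; exists u; rewrite /shifted_dual /=.
case: q q0 => // r _; rewrite mulrSr -addrA; apply: dual_coneD.
  exact: dual_coneMn.
by apply: ud; rewrite mem_head.
Qed.

Lemma shifted_dual_basis : exists B : seq M, (forall b, b \in B -> P b) /\
  forall m, P m -> exists2 b, b \in B & dual_cone s (m - b).
Proof.
have [g -> _] := ray_generatorsP hs.
have [B [BP Bgen]] := znonneg_finite_basis g d q0; exists B.
split=> [b /BP|m /dual_cone_span/Bgen[b bB /dual_cone_span mb]]; last by exists b.
by move=> bP; rewrite /shifted_dual /=; apply/dual_cone_span.
Qed.

(** A monomial clearing the finite basis clears everything, by [u + m = (u + b) + (m - b)]. *)
Lemma colon_shifted_dual_neq0 : colon s P !=set0.
Proof.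
have [B [_ Bgen]] := shifted_dual_basis.
have [u _ uB] := cone_clearable B; exists u => m /Bgen[b /uB ub mb].
by rewrite -(subrK b m) addrCA addrC; apply: dual_coneD; rewrite // addrC.
Qed.

(** For an extremal ray [x] with functional [u] and a point [b0] of [P] minimal on
    [x], the point [N u - b0] is in the colon for large [N], and pairing with it
    gives the inequality at [x]. *)
Lemma shifted_dual_reflexive : colon s (colon s P) `<=` P.
Proof.
have [B [BP Bgen]] := shifted_dual_basis; have [m0 /Bgen[b1 b1B _]] := shifted_dual_neq0.
have [g sg [_ rays]] := ray_generatorsP hs.
move=> m mcc; rewrite /shifted_dual /= sg; apply/dual_cone_span => x xg.
have [u ux upos] := rays x xg.
have [b0 b0B b0min] := exists_min (fun b => zdot b x) b1B.
(* Away from [x] the functional [u] is positive; at [x] it vanishes, and [b - b0] is nonnegative by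
   minimality of [b0]. *)
have [||N NP] := @znonneg_push _ g u [seq b - b0 | b <- B].
- by move=> y yg; have [->|/(upos y yg)/ltW//] := eqVneq y x; rewrite ux.
- move=> _ y /mapP[b bB ->] yg uy; have [->|/(upos y yg)] := eqVneq y x.
    by rewrite zdotBl subr_ge0 b0min.
  by rewrite uy ltxx.
have colon_u : colon s P (u *+ N - b0).
  move=> m' /Bgen[b bB mb].
  have -> : u *+ N - b0 + m' = u *+ N + (b - b0) + (m' - b).
    by rewrite -!addrA; congr (_ + _); rewrite [RHS]addrCA [b + _]addrC subrK.
  by apply: dual_coneD => //; rewrite sg; apply/dual_cone_span/NP/map_f.
have := mcc _ colon_u; rewrite sg => /dual_cone_span/(_ x xg).
have := BP b0 b0B; rewrite /shifted_dual /= sg => /dual_cone_span/(_ x xg).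
rewrite !zdotDl !zdotMnl ux mul0rn zdotNl.
by move: (zdot d x) (zdot b0 x) (zdot m x) => a b c; nia.
Qed.

End ShiftedDualCone.

(** * Sheaves spanned by monomials and their gradings *)

Section MonomialSheaf.
Variables (R : realType) (n : nat) (k : fieldType) (D : set (set 'rV[R]_n)).
Local Notation M := 'rV[int]_n.
Variables (P : D -> set M) (hP : forall s : D, stable (val s) (P s)).
Hypothesis subP : forall s t : D, face (val t) (val s) -> P s `<=` P t.

Definition mono_sections (s : D) : lmodType (chart_ring k s) :=
  monomial_module k (@hP s).

Fact mono_rstr_subproof (s t : D) (h : face (val t) (val s)) (x : monomial_module k (@hP s)) :
  val x \in supported_on k (P t).
Proof.
by apply/supported_onP => m xm; apply: (subP h); exact: (elimT (supported_onP _ _) (valP x)).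
Qed.

Definition mono_rstr (s t : D) (h : face (val t) (val s)) (x : mono_sections s) :
  mono_sections t := module_elt (@hP t) (mono_rstr_subproof h x).

Fact mono_rstrD s t (h : face (val t) (val s)) :
  {morph mono_rstr h : x y / x + y}.
Proof. by move=> x y; apply: val_inj. Qed.
Fact mono_rstrZ s t (h : face (val t) (val s)) (a : chart_ring k s) x :
  mono_rstr h (a *: x) = chart_incl h a *: mono_rstr h x.
Proof. exact: val_inj. Qed.
Fact mono_rstr_id s (h : face (val s) (val s)) x : mono_rstr h x = x.
Proof. exact: val_inj. Qed.
Fact mono_rstr_comp s t r (h : face (val t) (val s)) (h' : face (val r) (val t))
    (h'' : face (val r) (val s)) x :
  mono_rstr h' (mono_rstr h x) = mono_rstr h'' x.
Proof. exact: val_inj. Qed.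

Definition mono_mod : OYmod k D :=
  Build_OYmod mono_rstrD mono_rstrZ mono_rstr_id mono_rstr_comp.

Definition mono_val (s : D) (x : mono_mod s) : group_algebra k M :=
  val (x : monomial_module k (@hP s)).

Lemma mono_val_inj s : injective (@mono_val s).
Proof. exact: val_inj. Qed.

Lemma mono_val0 s : mono_val (0 : mono_mod s) = 0.
Proof. by []. Qed.

Lemma mono_valD s (x y : mono_mod s) : mono_val (x + y) = mono_val x + mono_val y.
Proof. by []. Qed.

Lemma mono_val_sum s (I : Type) (r : seq I) (F : I -> mono_mod s) :
  mono_val (\sum_(i <- r) F i) = \sum_(i <- r) mono_val (F i).
Proof. exact: (big_morph _ (@mono_valD s) (@mono_val0 s)). Qed.

Lemma mono_valZ s (a : chart_ring k s) (x : mono_mod s) :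
  mono_val (a *: x) = val a * mono_val x.
Proof. by []. Qed.

Lemma mono_val_supp s (x : mono_mod s) m : (mono_val x)@_m != 0 -> P s m.
Proof. by move: m; apply/supported_onP/(valP (x : monomial_module k (@hP s))). Qed.

Section Grading.
Variables (p e : nat) (d : M).
Hypothesis p0 : (0 < p)%N.
Local Notation deg m := (d + m *+ (p ^ e)).

(** The monomial [x^m] sits in degree [d + p^e m], so every degree outside the coset of [d] has only
    the zero section. *)
Definition mono_gr (s : D) (d' : M) : set (mono_mod s) :=
  [set x | forall m, (mono_val x)@_m != 0 -> d' = deg m].

Fact mono_gr_0 s d' : mono_gr d' (0 : mono_mod s).
Proof. by move=> m; rewrite mono_val0 mcoeff0 eqxx. Qed.
Fact mono_gr_D s d' (x y : mono_mod s) :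
  mono_gr d' x -> mono_gr d' y -> mono_gr d' (x + y).
Proof.
move=> dx dy m; rewrite mono_valD mcoeffD => xym.
have [xm|/dx//] := eqVneq ((mono_val x)@_m) 0.
by apply: dy; apply: contraNneq xym => ->; rewrite xm addr0.
Qed.
Fact mono_gr_Z s m d' (a : chart_ring k s) (x : mono_mod s) :
  homogeneous m a -> mono_gr d' x -> mono_gr (d' + m *+ (p ^ e)) (a *: x).
Proof.
move=> [c ac] dx m'; rewrite mono_valZ ac mcoeff_monomM mulf_eq0 negb_or.
by move=> /andP[_ /dx ->]; rewrite -addrA -mulrnDl subrK.
Qed.
Fact mono_gr_rstr s t (h : face (val t) (val s)) d' (x : mono_mod s) :
  mono_gr d' x -> mono_gr d' (rstr h x).
Proof. by []. Qed.
Fact mono_component_subproof s (x : mono_mod s) m :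
  ga_monom (mono_val x)@_m m \in supported_on k (P s).
Proof.
apply/supported_onP => m'; rewrite mcoeff_monom.
by have [<- /mono_val_supp|_] := eqVneq m m'; last by rewrite eqxx.
Qed.
Fact mono_gr_gen s (x : mono_mod s) : exists (l : seq M) (c : M -> mono_mod s),
  [/\ uniq l, forall d', mono_gr d' (c d') & x = \sum_(d' <- l) c d'].
Proof.
have deg_inj : injective (fun m : M => deg m).
  by move=> m m' /addrI; apply: mulrn_row_inj; rewrite expn_gt0 p0.
(* Degrees outside the coset get the component 0; inside it, injectivity of [deg] makes the chosen
   exponent the only one. *)
pose c d' : mono_mod s := if pselect (exists m, deg m = d') is left ex
  then module_elt (@hP s) (mono_component_subproof x (projT1 (cid ex))) else 0.
have cE m : mono_val (c (deg m)) = ga_monom (mono_val x)@_m m.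
  rewrite /c; case: pselect => [ex|[]]; last by exists m.
  by case: (cid ex) => m' /= /deg_inj ->.
exists [seq deg m | m <- msupp (mono_val x)], c; split.
- by rewrite map_inj_uniq // fset_uniq.
- move=> d'; have [[m <-] m'|nd'] := pselect (exists m, deg m = d').
    by rewrite cE mcoeff_monom; have [->//|_] := eqVneq m m'; rewrite eqxx.
  by rewrite /c; case: pselect => // _; apply: mono_gr_0.
- apply: mono_val_inj; rewrite mono_val_sum big_map {1}(ga_monomE (mono_val x)).
  by apply: eq_bigr => m _; rewrite cE.
Qed.
Fact mono_gr_free s (l : seq M) (c : M -> mono_mod s) : uniq l ->
  (forall d', mono_gr d' (c d')) -> \sum_(d' <- l) c d' = 0 ->
  forall d', d' \in l -> c d' = 0.
Proof.
move=> ul cg c0 d' dl; apply: mono_val_inj; rewrite mono_val0; apply/malgP => m.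
rewrite mcoeff0; apply/eqP/negPn/negP => cm.
have : (mono_val (\sum_(d' <- l) c d'))@_m = 0 by rewrite c0 mono_val0 mcoeff0.
rewrite mono_val_sum raddf_sum (bigD1_seq d') //= big1 ?addr0 => [/eqP|d'' dd].
  by rewrite (negPf cm).
by apply/eqP; apply: contraNT dd => /cg ->; rewrite (cg _ _ cm).
Qed.

Definition mono_equivariant : equivariant k D p e :=
  Build_equivariant mono_gr_0 mono_gr_D mono_gr_Z mono_gr_rstr mono_gr_gen
    mono_gr_free.

End Grading.
End MonomialSheaf.

(** * Coherence and reflexivity of the shifted sheaves *)

Section ShiftedSheaf.
Variables (R : realType) (n : nat) (k : fieldType) (D : set (set 'rV[R]_n)).
Local Notation M := 'rV[int]_n.

Lemma mono_mod_iso (P P' : D -> set M) hP hP' subP subP' : P = P' ->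
  OYiso (@mono_mod R n k D P hP subP) (@mono_mod R n k D P' hP' subP').
Proof.
move=> PP; subst P'; rewrite (Prop_irrelevance hP' hP) (Prop_irrelevance subP' subP).
by exists (@Build_OYhom _ _ _ _ (mono_mod k hP subP) (mono_mod k hP subP)
  (fun s => idfun) (fun _ _ _ _ => erefl)) => s; exists id.
Qed.

Definition shift (q : nat) (d : M) (s : D) : set M := shifted_dual (val s) q d.

Lemma shift_stable q d s : stable (val s) (shift q d s).
Proof. exact: shifted_dual_stable. Qed.

Lemma shift_sub q d (s t : D) : face (val t) (val s) -> shift q d s `<=` shift q d t.
Proof. by move=> h m; apply: face_dual_cone. Qed.

Definition shift_mod q d : OYmod k D := mono_mod k (@shift_stable q d) (@shift_sub q d).

(** The grading data [e], [d0] are kept independent of the shift [q], [d]: summands of the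
    pushforward take [q = p^e] and [d0 = d], whereas the finitely many model sheaves all carry a
    grading with [e = 0]. *)
Definition shift_equivariant p e d0 q d (p0 : (0 < p)%N) : equivariant k D p e :=
  mono_equivariant k (@shift_stable q d) (@shift_sub q d) e d0 p0.

Hypothesis hD : is_fan D.

Lemma chart_cone (s : D) : is_cone (val s).
Proof. by case: hD => _ + _ _; apply; apply: set_valP. Qed.

Variables (q : nat) (d : M).
Hypothesis q0 : (0 < q)%N.

(** Restrictions are inclusions inside the group algebra, so no nonzero section restricts to zero. A
    section over a face is carried to one over the larger chart by the monomial of [face_push],
    which is invertible on the face. *)
Lemma shift_mod_coherent : coherent (shift_mod q d).
Proof.
split=> [s t h|s]; last first.
  have [B [BP Bgen]] := shifted_dual_basis (chart_cone s) d q0.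
  exact: monomial_module_fg BP Bgen.
split=> [y|x x0]; last first.
  exists 1; split; first by exists 1; rewrite rmorph1 mulr1.
  by rewrite scale1r; apply: mono_val_inj; exact: (congr1 (@mono_val _ _ _ _ _ _ _ t) x0).
have [g sg _] := ray_generatorsP (chart_cone s); have h' := h; rewrite sg in h'.
have [|u []] := @face_push _ _ g (val t) q d (msupp (mono_val y)) q0 h'.
  by move=> m; rewrite -mcoeff_neq0 => /mono_val_supp.
rewrite -sg => us ut yu.
have xP : ga_monom 1 u * mono_val y \in supported_on k (shift q d s).
  apply/supported_onP => m; rewrite mcoeff_monomM mul1r mcoeff_neq0 => /yu.
  by rewrite [u + _]addrC subrK.
exists (monom_in k us), (module_elt (@shift_stable q d s) xP).
split; last exact: mono_val_inj.
exists (monom_in k ut); apply: val_inj.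
by transitivity (ga_monom (1 * 1 : k) (u - u)); [exact: ga_monomM|rewrite mulr1 subrr].
Qed.

Lemma shift_mod_rank_one_reflexive : rank_one_reflexive (shift_mod q d).
Proof.
split=> [|s|s]; first exact: shift_mod_coherent.
- apply: monomial_module_reflexive.
  + exact: cone_clearable (chart_cone s).
  + exact (shifted_dual_neq0 (chart_cone s) d q0).
  + exact (colon_shifted_dual_neq0 (chart_cone s) d q0).
  + exact (shifted_dual_reflexive (chart_cone s) q0).
- apply: monomial_module_rank; first exact: cone_clearable (chart_cone s).
  exact (shifted_dual_neq0 (chart_cone s) d q0).
Qed.

End ShiftedSheaf.

(** * Roots of coefficients and cosets of [p^e M] *)

Section FrobeniusRoots.
Variables (k : fieldType) (p : nat) (hp : p \in [pchar k]) (e : nat).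
Hypothesis k_perfect : forall x : k, exists y : k, y ^+ p = x.
Local Notation q := (p ^ e)%N.

Lemma pchar_exp_gt0 : (0 < q)%N.
Proof. by rewrite expn_gt0 prime_gt0 // (pcharf_prime hp). Qed.

Lemma pchar_expD (B : comNzRingType) (x y : B) : p \in [pchar B] ->
  (x + y) ^+ q = x ^+ q + y ^+ q.
Proof. by move=> hB; apply: exprDn_pchar; rewrite pnatX pnatE ?(pcharf_prime hp) ?hB. Qed.

Lemma pchar_exp_inj : injective (fun x : k => x ^+ q).
Proof.
move=> x y xy; apply/eqP; rewrite -subr_eq0.
have : (x - y) ^+ q == 0; last by rewrite expf_eq0 => /andP[].
rewrite pchar_expD // exprNn_pchar; last by rewrite pnatX pnatE ?(pcharf_prime hp) ?hp.
by rewrite [X in X - _]xy subrr.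
Qed.

Lemma perfect_root : exists root : k -> k, forall x, root x ^+ q = x.
Proof.
suff /boolp.choice[root rootK] : forall x, exists y : k, y ^+ q = x by exists root.
elim: e => [|e' IH] x; first by exists x; rewrite expn0 expr1.
have [y <-] := k_perfect x; have [z <-] := IH y.
by exists z; rewrite -exprM -expnSr.
Qed.

Definition frob_root : k -> k := projT1 (cid perfect_root).

Lemma frob_rootK x : frob_root x ^+ q = x.
Proof. exact: (projT2 (cid perfect_root)). Qed.

Lemma frob_rootX x : frob_root (x ^+ q) = x.
Proof. by apply: pchar_exp_inj; rewrite frob_rootK. Qed.

Lemma frob_root0 : frob_root 0 = 0.
Proof. by apply: pchar_exp_inj; rewrite frob_rootK expr0n (gtn_eqF pchar_exp_gt0). Qed.

Lemma frob_rootD x y : frob_root (x + y) = frob_root x + frob_root y.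
Proof. by apply: pchar_exp_inj; rewrite pchar_expD // !frob_rootK. Qed.

Lemma frob_rootM x y : frob_root (x * y) = frob_root x * frob_root y.
Proof. by apply: pchar_exp_inj; rewrite exprMn !frob_rootK. Qed.

Lemma frob_root_neq0 x : frob_root x != 0 -> x != 0.
Proof. by apply: contraNneq => ->; rewrite frob_root0. Qed.

Variable n : nat.
Local Notation M := 'rV[int]_n.
Local Notation kM := (group_algebra k M).
Implicit Types (d m : M) (f : kM).

Fact coset_root_subproof d : exists F : kM -> kM,
  forall f m, (F f)@_m = frob_root f@_(d + m *+ q).
Proof.
suff /boolp.choice[F FE] : forall f, exists g : kM,
  forall m, g@_m = frob_root f@_(d + m *+ q) by exists F.
elim/ga_ind => [|f g [f' fE] [g' gE]|c m'].
- by exists 0 => m; rewrite !mcoeff0 frob_root0.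
- by exists (f' + g') => m; rewrite !mcoeffD frob_rootD fE gE.
have [[m0 ->]|nm] := pselect (exists m, m' = d + m *+ q).
  exists (ga_monom (frob_root c) m0) => m; rewrite !mcoeff_monom.
  rewrite (inj_eq (addrI d)); have [->|mm] := eqVneq m0 m; first by rewrite eqxx.
  case: eqP => [/(mulrn_row_inj pchar_exp_gt0)/eqP|_]; first by rewrite (negPf mm).
  by rewrite !mulr0n frob_root0.
exists 0 => m; rewrite mcoeff0 mcoeff_monom; case: eqP => [m'E|_].
  by case: nm; exists m.
by rewrite mulr0n frob_root0.
Qed.

(** The part of [f] in the coset [d + q M], transported to [M] by [q]-th roots. *)
Definition coset_root d : kM -> kM := projT1 (cid (coset_root_subproof d)).

Lemma coset_rootE d f m : (coset_root d f)@_m = frob_root f@_(d + m *+ q).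
Proof. exact: (projT2 (cid (coset_root_subproof d))). Qed.

Lemma coset_rootD d f g : coset_root d (f + g) = coset_root d f + coset_root d g.
Proof. by apply/malgP => m; rewrite mcoeffD !coset_rootE mcoeffD frob_rootD. Qed.

Lemma pchar_group_algebra : p \in [pchar kM].
Proof.
rewrite inE (pcharf_prime hp) /=; apply/eqP.
by rewrite -[1]/(ga_monom 1 0 : kM) -monalgUMn (pcharf0 hp) monalgU0.
Qed.

(** This is linearity for the Frobenius-twisted action. Both sides are additive in [a], and for a
    monomial [a = c x^m0] the power is [c^q x^(q m0)], which preserves cosets. *)
Lemma coset_rootZ d (a f : kM) : coset_root d (a ^+ q * f) = a * coset_root d f.
Proof.
elim/ga_ind: a => [|a b IHa IHb|c m0].
- apply/malgP => m; rewrite coset_rootE expr0n (gtn_eqF pchar_exp_gt0) !mul0r !mcoeff0.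
  exact: frob_root0.
- rewrite pchar_expD; last exact: pchar_group_algebra.
  rewrite [X in coset_root _ X]mulrDl [RHS]mulrDl coset_rootD.
  exact (f_equal2 +%R IHa IHb).
- apply/malgP => m; rewrite coset_rootE ga_monomX !mcoeff_monomM frob_rootM.
  by rewrite frob_rootX coset_rootE mulrnBl addrA.
Qed.

(** A right inverse of [coset_root d] with values supported on the coset, used for surjectivity of
    the decomposition. *)
Lemma coset_power d f : exists g : kM, (forall m, g@_(d + m *+ q) = f@_m ^+ q) /\
  forall m', g@_m' != 0 -> exists m, m' = d + m *+ q.
Proof.
elim/ga_ind: f => [|f1 f2 [g1 [g1E g1s]] [g2 [g2E g2s]]|c m0].
- exists 0; split=> [m|m']; last by rewrite mcoeff0 eqxx.
  by rewrite !mcoeff0 expr0n (gtn_eqF pchar_exp_gt0).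
- exists (g1 + g2); split=> [m|m']; first by rewrite !mcoeffD g1E g2E pchar_expD.
  rewrite mcoeffD => g12; have [g1m|/g1s//] := eqVneq (g1@_m') 0.
  by apply: g2s; apply: contraNneq g12 => ->; rewrite g1m addr0.
- exists (ga_monom (c ^+ q) (d + m0 *+ q)); split=> [m|m'].
    rewrite !mcoeff_monom (inj_eq (addrI d)).
    have [->|mm] := eqVneq m0 m; first by rewrite eqxx.
    case: eqP => [/(mulrn_row_inj pchar_exp_gt0)/eqP|_]; first by rewrite (negPf mm).
    by rewrite !mulr0n expr0n (gtn_eqF pchar_exp_gt0).
  rewrite mcoeff_monom; have [<- _|_] := eqVneq (d + m0 *+ q) m'; first by exists m0.
  by rewrite eqxx.
Qed.

Definition coset_index : finType := {ffun 'I_n -> 'I_q}.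

(** Representatives are taken in the box [[0, p^e)^n]; the bound on the floors rests on this
    choice. *)
Definition coset_rep (j : 'I_#|coset_index|) : M :=
  \row_i (nat_of_ord ((enum_val j : {ffun 'I_n -> 'I_q}) i))%:Z.

Lemma coset_repP m' : exists j m, m' = coset_rep j + m *+ q.
Proof.
have q0 : (q : int) != 0 by rewrite -lt0n pchar_exp_gt0.
have lt (i : 'I_n) : (`|(m' ord0 i %% q)%Z| < q)%N.
  rewrite -ltz_nat gez0_abs ?modz_ge0 //.
  by rewrite ltz_pmod // ltz_nat pchar_exp_gt0.
exists (enum_rank [ffun i => Ordinal (lt i)] ), (\row_i (m' ord0 i %/ q)%Z).
apply/rowP => i; rewrite !mxE enum_rankK ffunE /= mulmxnE mxE gez0_abs ?modz_ge0 //.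
by rewrite {1}(divz_eq (m' ord0 i) q) addrC -mulr_natr natz.
Qed.

Lemma small_residue_eq (r a b : nat) (x y : int) : (a < r)%N -> (b < r)%N ->
  a%:Z + x *+ r = b%:Z + y *+ r -> a = b.
Proof.
move=> ar br /(congr1 (modz^~ r)).
rewrite -[x *+ r]mulr_natr -[y *+ r]mulr_natr !natz (addrC a%:Z) (addrC b%:Z).
rewrite !modzMDl !modz_small ?lez_nat ?ltz_nat //.
by case.
Qed.

Lemma coset_rep_inj i j m m' :
  coset_rep i + m *+ q = coset_rep j + m' *+ q -> i = j /\ m = m'.
Proof.
move=> ij; suff {}ijE : i = j.
  split=> //; move: ij; rewrite ijE => /addrI; exact: mulrn_row_inj pchar_exp_gt0.
apply: enum_val_inj; apply/ffunP => l; apply: val_inj.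
move/rowP: ij => /(_ l); rewrite !mxE !mulmxnE.
by apply: small_residue_eq; apply: ltn_ord.
Qed.

End FrobeniusRoots.

(** * Decomposition of the Frobenius pushforward *)

Section FrobeniusDecomposition.
Variables (R : realType) (n : nat) (k : fieldType) (D : set (set 'rV[R]_n)).
Variables (p : nat) (hp : p \in [pchar k]) (e : nat).
Hypothesis k_perfect : forall x : k, exists y : k, y ^+ p = x.
Local Notation M := 'rV[int]_n.
Local Notation q := (p ^ e)%N.
Local Notation m := #|coset_index p e n|.

(** Here [x^m] stands for [x^(d + p^e m)] in [F^e_* O_Y], whence its degree. *)
Definition frob_summand (j : 'I_m) : equivariant k D p e :=
  shift_equivariant k D e (coset_rep j) q (coset_rep j)
    (prime_gt0 (pcharf_prime hp)).
Local Notation F := (frob_mod D hp e).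
Local Notation S := (sum_mod frob_summand).

Definition frob_val (s : D) (x : F s) : group_algebra k M :=
  val (x : chart_ring k s).

Lemma frob_val_supp s (x : F s) m' : (frob_val x)@_m' != 0 -> dual_cone (val s) m'.
Proof. by move: m'; apply/semigroup_algP/(valP (x : chart_ring k s)). Qed.

Definition summand_val (s : D) (y : S s) (j : 'I_m) : group_algebra k M :=
  mono_val ((y : dsum (fun j => frob_summand j s)) j : mono_mod _ _ _ s).

Lemma summand_val_inj s (x y : S s) : summand_val x =1 summand_val y -> x = y.
Proof. by move=> xy; apply/ffunP => j; apply: mono_val_inj; exact: (xy j). Qed.

Lemma frob_valD s (x y : F s) : frob_val (x + y) = frob_val x + frob_val y.
Proof. by []. Qed.

Lemma frob_valZ s (a : chart_ring k s) (x : F s) :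
  frob_val (a *: x) = val a ^+ q * frob_val x.
Proof.
transitivity (val (a ^+ q) * frob_val x); first by [].
by congr (_ * _); exact: rmorphXn.
Qed.

Lemma summand_valD s (x y : S s) j :
  summand_val (x + y) j = summand_val x j + summand_val y j.
Proof. by rewrite /summand_val ffunE. Qed.

Lemma summand_valZ s (a : chart_ring k s) (x : S s) j :
  summand_val (a *: x) j = val a * summand_val x j.
Proof. by rewrite /summand_val ffunE. Qed.

Fact frob_part_subproof s (x : F s) (j : 'I_m) :
  coset_root hp e k_perfect (coset_rep j) (frob_val x)
    \in supported_on k (shift q (coset_rep j) s).
Proof.
apply/supported_onP => m'; rewrite coset_rootE => /(frob_root_neq0 hp)/frob_val_supp.
by rewrite addrC.
Qed.

Definition frob_decomp (s : D) (x : F s) : S s :=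
  [ffun j => module_elt (@shift_stable R n D q (coset_rep j) s) (frob_part_subproof x j)
     : frob_summand j s].

Lemma frob_decompE s (x : F s) j :
  summand_val (frob_decomp x) j = coset_root hp e k_perfect (coset_rep j) (frob_val x).
Proof. by rewrite /summand_val ffunE. Qed.

Fact frob_decomp_linear s : linear (@frob_decomp s).
Proof.
move=> a x y; apply: summand_val_inj => j.
rewrite frob_decompE frob_valD frob_valZ coset_rootD coset_rootZ.
by rewrite summand_valD summand_valZ !frob_decompE.
Qed.
HB.instance Definition _ s := GRing.isLinear.Build (chart_ring k s) (F s) (S s) *:%R
  (@frob_decomp s) (@frob_decomp_linear s).

Fact frob_decomp_rstr s t (h : face (val t) (val s)) x :
  frob_decomp (rstr h x : F t) = rstr h (frob_decomp x).
Proof.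
by apply: summand_val_inj => j; rewrite frob_decompE /summand_val /= !ffunE.
Qed.

Definition frob_decomp_hom : OYhom F S :=
  @Build_OYhom _ _ _ _ F S (fun s => @frob_decomp s : {linear F s -> S s}) frob_decomp_rstr.

Lemma frob_decomp_coeff s (x : F s) j m' :
  (summand_val (frob_decomp x) j)@_m' =
  frob_root e k_perfect (frob_val x)@_(coset_rep j + m' *+ q).
Proof. by rewrite frob_decompE coset_rootE. Qed.

Lemma frob_decomp_neq0 s (x : F s) j m' :
  ((summand_val (frob_decomp x) j)@_m' != 0) = ((frob_val x)@_(coset_rep j + m' *+ q) != 0).
Proof.
rewrite frob_decomp_coeff; apply/idP/idP; first exact: (frob_root_neq0 hp).
by apply: contraNneq => xr; rewrite -(frob_rootK e k_perfect (frob_val x)@__) xr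
  expr0n (gtn_eqF (pchar_exp_gt0 hp e)).
Qed.

(** Every exponent lies in exactly one coset. Existence of the coset gives injectivity; its
    uniqueness lets the lifts [G j] of the components be added without interference. *)
Lemma frob_decomp_bijective s : bijective (@frob_decomp s).
Proof.
apply: inj_surj_bijective => [x y xy|y].
  apply: val_inj; apply/malgP => m'; have [j [m'' ->]] := coset_repP hp e m'.
  have := congr1 (fun z => (summand_val z j)@_m'') xy; rewrite !frob_decomp_coeff.
  by move=> /(congr1 (fun c => c ^+ q)); rewrite !frob_rootK.
have [G GP] := boolp.choice (fun j => coset_power hp e (coset_rep j) (summand_val y j)).
pose g := \sum_j G j.
have gE j m' : g@_(coset_rep j + m' *+ q) = (summand_val y j)@_m' ^+ q.
  rewrite /g raddf_sum (bigD1 j) //= (proj1 (GP j)) big1 ?addr0 // => i ij.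
  apply/eqP; apply: contraNT ij => /(proj2 (GP i))[m''].
  by move=> /(coset_rep_inj hp)[->].
have gA : g \in semigroup_alg k (val s).
  apply/semigroup_algP => m'; have [j [m'' ->]] := coset_repP hp e m'.
  rewrite gE => yq; rewrite addrC; apply: (@mono_val_supp _ _ _ _ (shift q (coset_rep j))
    _ _ s ((y : dsum (fun j => frob_summand j s)) j)).
  by apply: contraNneq yq; rewrite /summand_val => ->;
    rewrite expr0n (gtn_eqF (pchar_exp_gt0 hp e)).
exists (ring_elt gA : F s); apply: summand_val_inj => j; apply/malgP => m'.
by rewrite frob_decomp_coeff [frob_val _]/= gE frob_rootX.
Qed.

Lemma sum_grE s d (y : S s) : @gr _ _ _ _ _ _ (equivariant_sum frob_summand) s d y <->
  forall j m', (summand_val y j)@_m' != 0 -> d = coset_rep j + m' *+ q.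
Proof. by split. Qed.

Lemma frob_pushforward_iso :
  equivariant_iso (frob_pushforward D hp e) (equivariant_sum frob_summand).
Proof.
exists frob_decomp_hom => [s|s d x]; first exact: frob_decomp_bijective.
split=> [[c xc]|/sum_grE gx].
  apply/sum_grE => j m'.
  rewrite frob_decomp_neq0.
  rewrite [frob_val _]xc mcoeff_monom.
  by have [->//|_] := eqVneq d (coset_rep j + m' *+ q); rewrite eqxx.
exists (frob_val x)@_d; apply/malgP => m'; rewrite mcoeff_monom.
have [<-//|dm] := eqVneq d m'; rewrite mulr0n; apply/eqP; apply: contraNT dm => xm.
have [j [m'' m'E]] := coset_repP hp e m'; rewrite m'E in xm *.
by rewrite -frob_decomp_neq0 in xm; rewrite (gx j m'' xm).
Qed.

End FrobeniusDecomposition.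

(** * Finiteness *)

(** Finiteness of the fan gives a single list [L] serving all charts, so that finitely many integers
    can control a whole sheaf. *)
Lemma fan_generators (R : realType) (n : nat) (D : set (set 'rV[R]_n)) : is_fan D ->
  exists (g : D -> seq 'rV[int]_n) (L : seq 'rV[int]_n),
    (forall s, val s = cone_span (g s)) /\ forall s, {subset g s <= L}.
Proof.
case=> [[/finite_seqP[Ds DE] _] cones _ _].
pose g (s : set 'rV[R]_n) : seq 'rV[int]_n :=
  if pselect (exists g, s = cone_span g) is left ex then projT1 (cid ex) else [::].
exists (fun s => g (val s)), (flatten [seq g s | s <- Ds]); split=> s.
  rewrite /g; case: pselect => [ex|[]]; first exact: (projT2 (cid ex)).
  by case: (cones (val s)) => //; apply: set_valP.
move=> x xs; apply/flattenP; exists (g (val s)) => //; apply: map_f.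
by have : D (val s) by [apply: set_valP]; rewrite {1}DE.
Qed.

Section Floors.
Variable n : nat.
Implicit Types (d m x : 'rV[int]_n) (q : nat).

(** As [zdot m x] is an integer, [q (m.x) + d.x >= 0] can be divided by [q] and rounded down. Hence
    [q] and [d] matter only through the floors. *)
Lemma shifted_dual_floor (R : realType) (g : seq 'rV[int]_n) q d m : (0 < q)%N ->
  shifted_dual (cone_span (R:=R) g) q d m <->
  forall x, x \in g -> 0 <= zdot m x + (zdot d x %/ q)%Z.
Proof.
move=> q0; have E x : (0 <= zdot m x + (zdot d x %/ q)%Z) = (0 <= zdot (m *+ q + d) x).
  rewrite -divzMDl ?divz_ge0 ?ltz_nat //; last by rewrite -lt0n.
  by rewrite zdotDl zdotMnl -mulr_natr natz.
by split=> [/dual_cone_span mg x /mg|mg]; [rewrite E|apply/dual_cone_span => x /mg; rewrite E].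
Qed.

(** From [0 <= d_i < q] one gets [|d.x| <= q (|x_1| + ... + |x_n|)], so the bound after division is
    independent of [q]. *)
Lemma floor_bound q d x : (0 < q)%N -> (forall i, 0 <= d 0 i < q%:Z) ->
  `|(zdot d x %/ q)%Z| <= \sum_i `|x 0 i|.
Proof.
move=> q0 dq; have : `|zdot d x| <= (\sum_i `|x 0 i|) * q%:Z.
  rewrite zdotE (le_trans (ler_norm_sum _ _ _)) // mulr_suml ler_sum // => i _.
  rewrite normrM mulrC ler_wpM2l //; have /andP[d0 /ltW dlt] := dq i.
  by rewrite ger0_norm.
rewrite !ler_norml => /andP[lo hi]; have q0' : 0 < q%:Z by rewrite ltz_nat.
rewrite lez_divRL // mulNr lo /= -(ler_pM2r q0').
by rewrite (le_trans (lez_floor _ _)) // gt_eqF.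
Qed.

(** Adding [B] moves floors in [[-B, B]] to [[0, 2B]], so the codes live in a finite type that does
    not involve [q]. *)
Definition floor_code (L : seq 'rV[int]_n) (B q : nat) d :
  {ffun 'I_(size L) -> 'I_(B + B).+1} :=
  [ffun i => inord `|((zdot d (tnth (in_tuple L) i) %/ q)%Z + B%:Z)%R|%N].

Lemma floor_code_inj (L : seq 'rV[int]_n) B q d q' d' :
  (forall x, x \in L -> `|(zdot d x %/ q)%Z| <= B%:Z) ->
  (forall x, x \in L -> `|(zdot d' x %/ q')%Z| <= B%:Z) ->
  floor_code L B q d = floor_code L B q' d' ->
  forall x, x \in L -> (zdot d x %/ q)%Z = (zdot d' x %/ q')%Z.
Proof.
move=> dB dB' /ffunP cc x xL.
have xi : (index x L < size L)%N by rewrite index_mem.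
have := cc (Ordinal xi); rewrite !ffunE (tnth_nth 0) /= nth_index //.
move/(congr1 val); have := dB x xL; have := dB' x xL.
move: (divz _ _) (divz _ _) => a b aB bB /=.
by rewrite !inordK; lia.
Qed.

End Floors.
Theorem proposition16p4 (R : realType) (k : fieldType) (p : nat)
    (hp : p \in [pchar k]) (k_perfect : forall x : k, exists y : k, y ^+ p = x)
    (n : nat) (D : set (set 'rV[R]_n)) (hD : is_fan D) :
  exists (u e0 : nat) (Ms : 'I_u -> equivariant k D p e0),
    (forall l, rank_one_reflexive (Ms l)) /\ graded_FFRT_by hp Ms.

Proof.
have p0 : (0 < p)%N by rewrite prime_gt0 // (pcharf_prime hp).
have q0 e : (0 < p ^ e)%N by rewrite expn_gt0 p0.
have [g [L [gE gL]]] := fan_generators hD.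
pose B := (\sum_(x <- L) \sum_i `|x ord0 i|)%N.
pose reduced (ed : nat * 'rV[int]_n) := forall i, 0 <= ed.2 0 i < (p ^ ed.1)%:Z.
have reducedB ed : reduced ed ->
    forall x, x \in L -> `|(zdot ed.2 x %/ (p ^ ed.1)%N)%Z| <= B%:Z.
  move=> red x xL; apply: (le_trans (floor_bound _ _ red)) => //.
  rewrite /B (big_rem x xL) /= PoszD -[leLHS]addr0 lerD //.
  by rewrite -natz natr_sum ler_sum // => i _; rewrite natz.
pose code (ed : nat * 'rV[int]_n) := floor_code L B (p ^ ed.1) ed.2.
pose T : finType := {ffun 'I_(size L) -> 'I_(B + B).+1}.
(* One reduced pair is fixed for each attained code. Other codes receive the pair [(0, 0)], that is,
   no shift, which still defines a rank-one reflexive sheaf. *)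
pose pick (c : T) : nat * 'rV[int]_n :=
  if pselect (exists ed, reduced ed /\ code ed = c) is left ex then projT1 (cid ex)
  else (0%N, 0).
have pickP ed : reduced ed -> reduced (pick (code ed)) /\ code (pick (code ed)) = code ed.
  move=> red; rewrite /pick; case: pselect => [ex|[]]; last by exists ed.
  exact: (projT2 (cid ex)).
pose Ms (l : 'I_#|T|) : equivariant k D p 0 :=
  shift_equivariant k D 0 0 (p ^ (pick (enum_val l)).1) (pick (enum_val l)).2 p0.
exists #|T|, 0%N, Ms; split=> [l|].
  by apply: shift_mod_rank_one_reflexive.
split=> [l|e e1]; first by apply: shift_mod_coherent.
exists #|coset_index p e n|, (frob_summand D hp (e := e)); split=> [j||j].
- by apply: shift_mod_coherent.
- exact: frob_pushforward_iso.
have red : reduced (e, coset_rep j).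
  by move=> i; rewrite !mxE /= ltz_nat ltn_ord.
have [red' cc] := pickP _ red; exists (enum_rank (code (e, coset_rep j))).
apply: mono_mod_iso; rewrite enum_rankK; apply/funext => s; apply/seteqP.
(* Equal codes mean equal floors on all generators, hence the same exponent set on every chart. *)
have fl x : x \in g s -> (zdot (coset_rep j) x %/ (p ^ e)%N)%Z =
    (zdot (pick (code (e, coset_rep j))).2 x %/
      (p ^ (pick (code (e, coset_rep j))).1)%N)%Z.
  by move=> /gL; apply: (floor_code_inj (reducedB _ red) (reducedB _ red') (esym cc)).
rewrite /shift gE; split=> m /(shifted_dual_floor _ _ _ _ (q0 _)) mg;
  apply/(shifted_dual_floor _ _ _ _ (q0 _)) => x xg.
  by rewrite -fl //; apply: mg.
by rewrite fl //; apply: mg.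
Qed.
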